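(* Assume that the pushforward $\bar\mu=\mu\circ v^{-1}$ is irreducible and contracting. Then, for every $s\in I_\mu$, the probability measure $\mathbb{Q}^s$ on $\Omega=\mathcal{A}^{\mathbb{N}}$ is ergodic for the shift $\theta$.
   Context: Setting. $d\ge1$; $\|\cdot\|$ is the Euclidean norm on $\mathbb{C}^d$ and the induced operator norm on $M_d(\mathbb{C})$. $\mathcal{A}$ is a Polish space, $\mu$ a Borel measure on $\mathcal{A}$, $v:\mathcal{A}\to M_d(\mathbb{C})$, $a\mapsto v_a$, a measurable map, $\bar\mu=\mu\circ v^{-1}$. $I_\mu=(s_-,s_+)$ where $0<s_-<s_+\le+\infty$ and $\int_{\mathcal{A}}\|v_a\|^s d\mu(a)<\infty$ for every finite $s\in[s_-,s_+]$. $\Omega=\mathcal{A}^{\mathbb{N}}$ with product $\sigma$-algebra and left shift $\theta(a_1,a_2,\dots)=(a_2,a_3,\dots)$. A measure $\bar\mu$ on $M_d(\mathbb{C})$ is irreducible if no linear subspace $F$ with $\{0\}\ne F\ne\mathbb{C}^d$ satisfies $wF\subset F$ for all $w\in\operatorname{supp}\bar\mu$. It is contracting if, with $T$ the set of all finite products of elements of $\operatorname{supp}\bar\mu$ together with the identity, there is a sequence of nonzero $w_k\in T$ such that $w_k/\|w_k\|$ converges to a rank-one matrix. $\mathrm{P}(\mathbb{C}^d)$ is the projective space; for $\hat x\in\mathrm{P}(\mathbb{C}^d)$, $x$ denotes a unit representative; $w\cdot\hat x$ is the class of $wx$ when $wx\ne0$, and any expression $f(w\cdot\hat x)\|wx\|^s$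 is $0$ when $wx=0$. The topology is that of the metric $d(\hat x,\hat y)=\sqrt{1-|\langle x,y\rangle|^2}$. Let $k(s)=\lim_n\left(\int_{\mathcal{A}^n}\|v_{a_n}\cdots v_{a_1}\|^s d\mu^{\otimes n}\right)^{1/n}$, which is positive, and $\Gamma_sf(\hat x)=\int_{\mathcal{A}}f(v_a\cdot\hat x)\|v_ax\|^sd\mu(a)$. There are a unique continuous $e_s:\mathrm{P}(\mathbb{C}^d)\to\mathbb{R}_+$ and a unique probability measure $\sigma$ on $\mathrm{P}(\mathbb{C}^d)$ with $\Gamma_se_s=k(s)e_s$, $\int\Gamma_s\varphi\,d\sigma=k(s)\int\varphi\,d\sigma$ for all continuous $\varphi$, and $\int e_sd\sigma=1$; $e_s$ is strictly positive. Put $q^s_n(\hat x,A)=\frac{1}{k(s)^n}\frac{e_s(A\cdot\hat x)}{e_s(\hat x)}\|Ax\|^s$. For each $\hat x$, $\mathbb{Q}^s_{\hat x}$ is the probability measure on $\Omega$ whose marginal on the first $n$ coordinates is $q_n^s(\hat x,v_{a_n}\cdots v_{a_1})\,d\mu^{\otimes n}(a_1,\dots,a_n)$ for every $n\ge1$. The Markov operator $Q_sf(\hat x)=\int_{\mathcal{A}}f(v_a\cdot\hat x)q_1^s(\hat x,v_a)d\mu(a)$ has a unique invariant probability measure $\eta^s$, and $\mathbb{Q}^s=\int\mathbb{Q}^s_{\hat x}\,d\eta^s(\hat x)$ (a $\theta$-invariant measure). *)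

(* Defs.v *)
From HB Require Import structures.
From mathcomp Require Import all_boot all_order all_algebra.
From mathcomp Require Import all_classical all_reals all_analysis.
From mathcomp Require Import complex.
From mathcomp Require Import ring lra.

Set Implicit Arguments.
Unset Strict Implicit.
Unset Printing Implicit Defensive.

Import Order.TTheory GRing.Theory Num.Theory.
Import numFieldNormedType.Exports.

Local Open Scope classical_set_scope.
Local Open Scope ring_scope.

Notation borel T := (g_sigma_algebraType (@open T)).

Definition polish (R : realType) (T : topologicalType) : Prop :=
  (exists dist : T -> T -> R,
    [/\ forall x y, dist x y = 0 <-> x = y,
        forall x y, dist x y = dist y x,
        forall x y z, dist x z <= dist x y + dist y z,
        forall x, nbhs x = filter_from [set r : R | 0 < r]
                                       (fun r => [set y | dist x y < r])
      & forall u : nat -> T,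
          (forall r : R, 0 < r -> exists N, forall m n,
             (N <= m)%N -> (N <= n)%N -> dist (u m) (u n) < r) ->
          exists l : T, u @ \oo --> l]) /\
  (exists2 D : set T, countable D & dense D).

(* [R[i]] bundled as a numClosedFieldType: it is through this bundle that
   complex matrices inherit the topology of the library. *)
Definition Cx (R : realType) : numClosedFieldType := R[i].

Section Norms.
Context {R : realType}.
Local Notation C := (Cx R).

Definition hdot n (x y : 'cV[C]_n) : C := \sum_i x i 0 * (y i 0)^*.

Definition l2norm n (x : 'cV[C]_n) : R :=
  Num.sqrt (\sum_i Normc.normc (x i 0) ^+ 2).

Definition opnorm n (w : 'M[C]_n) : R :=
  sup [set l2norm (w *m x) | x in [set x | l2norm x = 1]].

Lemma normCE (z : C) : `|z| = (Normc.normc z)%:C%C :> C.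
Proof. by case: z. Qed.

Lemma hdotDl n (x y z : 'cV[C]_n) : hdot (x + y) z = hdot x z + hdot y z.
Proof.
by rewrite -big_split; apply: eq_bigr => i _; rewrite mxE mulrDl.
Qed.

Lemma hdotZl n (c : C) (x y : 'cV[C]_n) : hdot (c *: x) y = c * hdot x y.
Proof. by rewrite mulr_sumr; apply: eq_bigr => i _; rewrite mxE mulrA. Qed.

Lemma hdotC n (x y : 'cV[C]_n) : hdot x y = (hdot y x)^*.
Proof.
rewrite /hdot rmorph_sum; apply: eq_bigr => i _ /=.
by rewrite rmorphM /= conjCK mulrC.
Qed.

Lemma hdotDr n (x y z : 'cV[C]_n) : hdot x (y + z) = hdot x y + hdot x z.
Proof. by rewrite hdotC hdotDl rmorphD /= [hdot x y]hdotC [hdot x z]hdotC. Qed.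

Lemma hdotZr n (c : C) (x y : 'cV[C]_n) : hdot x (c *: y) = c^* * hdot x y.
Proof. by rewrite hdotC hdotZl rmorphM /= [hdot x y]hdotC. Qed.

Lemma hdotxx n (x : 'cV[C]_n) : hdot x x = ((l2norm x) ^+ 2)%:C%C.
Proof.
rewrite /l2norm sqr_sqrtr; last by apply: sumr_ge0 => i _; exact: sqr_ge0.
rewrite /hdot rmorph_sum; apply: eq_bigr => i _ /=.
by rewrite -normCK normCE rmorphXn.
Qed.

Lemma l2norm_ge0 n (x : 'cV[C]_n) : 0 <= l2norm x.
Proof. exact: sqrtr_ge0. Qed.

Lemma l2norm0_eq0 n (x : 'cV[C]_n) : l2norm x = 0 -> x = 0.
Proof.
move=> /eqP; rewrite sqrtr_eq0 => x0.
have /eqP : \sum_i Normc.normc (x i 0) ^+ 2 = 0.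
  by apply/eqP; rewrite eq_le x0 sumr_ge0 // => i _; exact: sqr_ge0.
rewrite psumr_eq0 => [/allP x0i|i _]; last exact: sqr_ge0.
apply/matrixP => i j; rewrite ord1 mxE; apply: Normc.eq0_normc.
by have := x0i i (mem_index_enum _); rewrite sqrf_eq0 => /eqP.
Qed.

Lemma normc_ge0 (c : C) : 0 <= Normc.normc c.
Proof. by case: c => a b; exact: sqrtr_ge0. Qed.

Lemma l2normZ n (c : C) (x : 'cV[C]_n) :
  l2norm (c *: x) = Normc.normc c * l2norm x.
Proof.
rewrite /l2norm -[X in X * _]ger0_norm ?normc_ge0// -sqrtr_sqr.
rewrite -sqrtrM ?sqr_ge0//; congr Num.sqrt; rewrite mulr_sumr.
by apply: eq_bigr => i _; rewrite mxE Normc.normcM exprMn.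
Qed.

(* For unit [y], [hdot x y *: y] is the orthogonal projection of [x] on the
   line of [y]. *)
Lemma l2norm_sub_proj n (x y : 'cV[C]_n) (c : C) : l2norm y = 1 ->
  l2norm (x - c *: y) ^+ 2 = l2norm x ^+ 2 - Normc.normc (hdot x y) ^+ 2
    + Normc.normc (hdot x y - c) ^+ 2.
Proof.
move=> y1; apply: (@complexI R).
rewrite !(rmorphD, rmorphN) /= -!hdotxx !rmorphXn /= -!normCE !normCK.
rewrite -scaleNr hdotDl !hdotDr !hdotZl !hdotZr (hdotxx y) y1 expr1n (hdotC y x).
rewrite !rmorphD !rmorphN /=.
set u := hdot x y; set u' := u^*; set c' := c^*; set z := hdot x x.
by rewrite rmorph1; ring.
Qed.

Lemma hdot_le n (x y : 'cV[C]_n) : l2norm y = 1 ->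
  Normc.normc (hdot x y) <= l2norm x.
Proof.
move=> y1; have := @l2norm_sub_proj n x y (hdot x y) y1.
rewrite subrr Normc.normc0 expr0n addr0 => xy.
rewrite -(@ler_pXn2r _ 2) ?nnegrE ?normc_ge0 ?l2norm_ge0 //.
by rewrite -subr_ge0 -xy sqr_ge0.
Qed.

Lemma l2normD n (x y : 'cV[C]_n) : l2norm (x + y) <= l2norm x + l2norm y.
Proof.
have [y0|y0] := eqVneq (l2norm y) 0.
  by rewrite y0 (l2norm0_eq0 y0) !addr0.
have ypos : 0 < l2norm y by rewrite lt_neqAle eq_sym y0 l2norm_ge0.
set b := l2norm y in ypos y0 *.
have [u yu u1] : exists2 u, y = (b%:C%C : C) *: u & l2norm u = 1.
  exists (((b^-1)%:C%C : C) *: y).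
    by rewrite scalerA -rmorphM divff // rmorph1 scale1r.
  rewrite l2normZ /= expr0n addr0 sqrtr_sqr ger0_norm ?invr_ge0 ?l2norm_ge0//.
  by rewrite mulVf.
have h := @l2norm_sub_proj n x u (- (b%:C%C : C)) u1.
move: h; rewrite scaleNr opprK -yu opprK => h.
rewrite -(@ler_pXn2r _ 2) ?nnegrE ?addr_ge0 ?l2norm_ge0 // h.
set t := hdot x u.
have tx : Normc.normc t <= l2norm x by exact: hdot_le.
have tb : Normc.normc (t + (b%:C%C : C)) <= Normc.normc t + b.
  apply: le_trans (le_normcD _ _) _.
  by rewrite lerD2l /= expr0n addr0 sqrtr_sqr ger0_norm ?l2norm_ge0.
have t0 := normc_ge0 t.
have tb0 := normc_ge0 (t + (b%:C%C : C)).
have x0 := l2norm_ge0 x.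
nra.
Qed.

End Norms.

Section Projective.
Context {R : realType} {d : nat}.
Local Notation C := (Cx R).

Definition proj_space : Type := {L : {vspace 'cV[C]_d.+1} | \dim L == 1%N}.

HB.instance Definition _ := Choice.on proj_space.

Implicit Types L M : proj_space.

Lemma urep_ex L : exists x, l2norm x = 1 /\ val L = <[x]>%VS.
Proof.
set y := vpick (val L).
have y0 : y != 0.
  by rewrite vpick0; apply/eqP => L0; have := valP L; rewrite L0 dimv0.
have ny0 : l2norm y != 0 by apply: contra y0 => /eqP/l2norm0_eq0 ->.
have x1 : l2norm (((l2norm y)^-1%:C%C : C) *: y) = 1.
  rewrite l2normZ /= expr0n addr0 sqrtr_sqr ger0_norm ?invr_ge0 ?l2norm_ge0//.
  by rewrite mulVf.
exists (((l2norm y)^-1%:C%C : C) *: y); split=> //.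
apply/esym/eqP; rewrite eqEdim dim_vline (eqP (valP L)) -memvE.
rewrite memvZ ?memv_pick // lt0b; apply/eqP => x0; move: x1.
rewrite x0 -(scale0r y) l2normZ Normc.normc0 mul0r => /eqP.
by rewrite eq_sym oner_eq0.
Qed.

(* A unit representative; no notion below depends on the choice. *)
Definition urep L : 'cV[C]_d.+1 := sval (cid (urep_ex L)).

(* The class of [w *m urep L]. When [w *m urep L = 0] the value is the junk
   value [L]; below it is always multiplied by [l2norm (w *m urep L) `^ s],
   which is then 0 because [s != 0]. *)
Definition pact (w : 'M[C]_d.+1) L : proj_space :=
  insubd L <[w *m urep L]>%VS.

Definition pdist L M : R :=
  Num.sqrt (1 - Normc.normc (hdot (urep L) (urep M)) ^+ 2).

Lemma l2norm_urep L : l2norm (urep L) = 1.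
Proof. by rewrite /urep; case: cid => x []. Qed.

Lemma proj_urep L : val L = <[urep L]>%VS.
Proof. by rewrite /urep; case: cid => x []. Qed.

Lemma pdistE L M :
  pdist L M = l2norm (urep L - hdot (urep L) (urep M) *: urep M).
Proof.
apply/esym; rewrite /pdist -[LHS]ger0_norm ?l2norm_ge0// -sqrtr_sqr.
rewrite l2norm_sub_proj ?l2norm_urep // expr1n subrr Normc.normc0.
by rewrite expr0n addr0.
Qed.

Lemma pdistxx L : pdist L L = 0.
Proof.
rewrite /pdist hdotxx l2norm_urep !expr1n Normc.normc1 expr1n subrr.
exact: sqrtr0.
Qed.

Lemma pdist_positivity L M : pdist L M = 0 -> L = M.
Proof.
rewrite pdistE => /l2norm0_eq0/eqP; rewrite subr_eq0 => /eqP LM.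
apply: val_inj; apply/eqP; rewrite eqEdim (eqP (valP L)) (eqP (valP M)) andbT.
by rewrite /= (proj_urep L) (proj_urep M) -memvE LM memvZ ?memv_line.
Qed.

Lemma pdist_sym L M : pdist L M = pdist M L.
Proof.
rewrite /pdist [hdot (urep L) _]hdotC.
suff -> : forall z : C, Normc.normc z^* = Normc.normc z by [].
by move=> z; apply: (@complexI R); rewrite -!normCE norm_conjC.
Qed.

Lemma pdist_le L M (c : C) : pdist L M <= l2norm (urep L - c *: urep M).
Proof.
have h := l2norm_sub_proj (urep L) c (l2norm_urep M).
rewrite -[leRHS]ger0_norm ?l2norm_ge0 -?sqrtr_sqr; last by [].
by apply: ler_wsqrtr; rewrite h l2norm_urep expr1n lerDl sqr_ge0.
Qed.

Lemma scale_telescope (K : pzRingType) (V : lmodType K) (a b : K) (x y z : V) :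
  x - (a * b) *: z = (x - a *: y) + a *: (y - b *: z).
Proof. by rewrite -scalerA scalerBr addrA subrK. Qed.

Lemma pdist_triangle M L N : pdist L N <= pdist L M + pdist M N.
Proof.
set a := hdot (urep L) (urep M); set b := hdot (urep M) (urep N).
apply: le_trans (pdist_le _ _ (a * b)) _.
rewrite (scale_telescope _ _ _ (urep M)); apply: le_trans (l2normD _ _) _.
have ha : Normc.normc a <= 1.
  by rewrite -(l2norm_urep L); apply: hdot_le; exact: l2norm_urep.
rewrite l2normZ (pdistE L M) (pdistE M N) -/a -/b; apply: lerD; first exact: lexx.
by apply: ler_piMl ha; exact: l2norm_ge0.
Qed.

HB.instance Definition _ := isMetric.Build R proj_space
  pdistxx pdist_positivity pdist_sym pdist_triangle.

Lemma proj_point_subproof :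
  \dim <[const_mx 1 : 'cV[C]_d.+1]>%VS == 1%N.
Proof.
rewrite dim_vline eqb1; apply/eqP => /matrixP/(_ 0 0)/eqP.
by rewrite !mxE oner_eq0.
Qed.

HB.instance Definition _ := isPointed.Build proj_space
  (exist (fun L : {vspace 'cV[C]_d.+1} => \dim L == 1%N) _
    proj_point_subproof).

End Projective.
Arguments proj_space : clear implicits.

Section SetsOfMatrices.
Context {R : realType} {d : nat}.
Local Notation M := 'M[Cx R]_d.+1.
Implicit Types (m : set (borel M) -> \bar R) (w : M).

Definition msupport m : set M :=
  [set w | forall U : set M, open U -> U w -> (0 < m U)%E].

Definition irreducible m : Prop :=
  ~ exists F : {vspace 'cV[Cx R]_d.+1},
      [/\ F != 0%VS, F != fullv &
          forall w, msupport m w -> forall x, x \in F -> w *m x \in F].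

Definition finite_products m : set M :=
  [set w | exists2 ws : seq M,
     (forall u, u \in ws -> msupport m u) & w = \prod_(u <- ws) u].

Definition contracting m : Prop :=
  exists (w : nat -> M) (w_lim : M),
    [/\ forall n, finite_products m (w n) /\ w n != 0,
        \rank w_lim = 1%N &
        (fun n => ((opnorm (w n))^-1%:C%C : Cx R) *: w n) @ \oo --> w_lim].

End SetsOfMatrices.

(* The integral of [F] against the [n]-fold product of [mu], written as an
   iterated integral because [mu] is not assumed sigma-finite; it is applied
   below to nonnegative [F] that vanish where some [v a_i] does, a set off which
   the moment condition makes [mu] sigma-finite. *)
Fixpoint iterated_integral dsp (T : measurableType dsp) (R : realType)
    (mu : {measure set T -> \bar R}) (n : nat) :
    (n.-tuple T -> \bar R) -> \bar R :=
  match n with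
  | 0 => fun F => F [tuple]
  | n'.+1 => fun F =>
      (\int[mu]_a iterated_integral mu
         (fun t : n'.-tuple T => F [tuple of a :: t]))%E
  end.

Section SequenceSpace.
Context {dsp : measure_display} (T : measurableType dsp).

Definition cylinders : set (set (nat -> T)) :=
  \bigcup_i preimage_set_system setT (fun w : nat -> T => w i) measurable.

Definition seq_space := g_sigma_algebraType cylinders.

(* Coordinates start at 0: [w i] is the letter $a_{i+1}$. *)
Definition left_shift (w : seq_space) : seq_space := fun i => w i.+1.

End SequenceSpace.

Definition ergodic dsp (T : measurableType dsp) (R : realType)
    (P : set T -> \bar R) (f : T -> T) : Prop :=
  (forall B, measurable B -> P (f @^-1` B) = P B) /\
  (forall B, measurable B -> f @^-1` B = B -> P B = 0%E \/ P B = 1%E).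

Section TransferOperators.
Context {R : realType} {d : nat} {A : ptopologicalType}.
Variables (mu : {measure set (borel A) -> \bar R}).
Variables (v : borel A -> 'M[Cx R]_d.+1) (s : R).
Implicit Types (x : proj_space R d) (f e : proj_space R d -> R) (k : R).

(* [v a_n *m ... *m v a_1] for [t = (a_1, ..., a_n)] *)
Definition vprod n (t : n.-tuple (borel A)) : 'M[Cx R]_d.+1 :=
  \prod_(a <- rev t) v a.

Definition growth_rate k : Prop :=
  (fun n => poweR (iterated_integral mu
                     (fun t : n.-tuple (borel A) => (opnorm (vprod t) `^ s)%:E))
                  n%:R^-1) @ \oo --> k%:E.

Definition Gamma f x : R :=
  \int[mu]_a (f (pact (v a) x) * l2norm (v a *m urep x) `^ s).

(* $q^s_n(x, w)$ *)
Definition density k e n x (w : 'M[Cx R]_d.+1) : R :=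
  (k ^+ n)^-1 * (e (pact w x) / e x) * l2norm (w *m urep x) `^ s.

(* $Q_s f(x)$ *)
Definition Qop k e f x : R :=
  \int[mu]_a (f (pact (v a) x) * density k e 1 x (v a)).

Definition Q_invariant k e
    (eta : probability (borel (proj_space R d)) R) : Prop :=
  forall f : borel (proj_space R d) -> R,
    measurable_fun setT f -> (exists b, forall x, `|f x| <= b) ->
    \int[eta]_x Qop k e f x = \int[eta]_x f x.

Definition Q_marginals k e x (Q : probability (seq_space (borel A)) R) : Prop :=
  forall (n : nat) (B : set (n.-tuple (borel A))), (0 < n)%N -> measurable B ->
    Q [set w | B [tuple w i | i < n]] =
    iterated_integral mu
      (fun t : n.-tuple (borel A) => (\1_B t * density k e n x (vprod t))%:E).

End TransferOperators.

(* Main.v *)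
(* Let [h x] be the probability, starting from [x], of a shift-invariant event.
   By the Markov property [h] is harmonic for [Q_s].  The invariant
   probability [eta] is unique, hence every bounded harmonic function is
   constant [eta]-almost everywhere: for [c] the mean of [h], the positive part
   of [h - c] is subharmonic with a [Q_s]-invariant integral, so the set
   [h > c] cannot be left nor entered, and [eta] conditioned on it would be
   another invariant probability unless the set is trivial.  Since [h] is
   almost everywhere constant, the event is independent of all cylinders,
   therefore of itself. *)
From HB Require Import structures.
Require Import Defs.
From mathcomp Require Import all_boot all_order all_algebra.
From mathcomp Require Import all_classical all_reals all_analysis.
From mathcomp Require Import complex.
From mathcomp Require Import measurable_realfun.
From mathcomp Require Import ring lra.
Import Order.TTheory GRing.Theory Num.Theory.
Import numFieldNormedType.Exports.
Local Open Scope classical_set_scope.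
Local Open Scope ring_scope.

(** * Cylinders of the sequence space *)

(** Two obstacles shape the proof. First, [mu] need not be sigma-finite, whereas measurability in
    the starting line rests on Tonelli. The eigenvalue equation makes [mu] sigma-finite off the zero
    set of [v], and on that set the weights of the chain vanish because [s > 0]; so [mu] is traded
    for a sigma-finite [m] giving the same integrals. Second, the unit representative [urep] is
    chosen without any regularity: only quantities blind to its phase, such as |<u, y>|^2, can be
    shown measurable, and the others are expressed through them. The ergodic argument is carried out
    for an abstract kernel, given by a map [phi] and a weight [q] of total mass one, acting on
    nonnegative extended functions so that integrability rarely intervenes. *)

Section Rectangles.
Set Implicit Arguments.
Unset Strict Implicit.
Context {dsp : measure_display} {T : measurableType dsp}.
Implicit Types (l : seq (set T)) (C : set T).

(** The recursion peels off the first letter and shifts, which is the form in which the Markov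
    property acts. *)
Definition rect l : set (seq_space T) :=
  foldr (fun C S => [set w | C (w 0%N)] `&` @left_shift _ T @^-1` S) setT l.

(** Past the end [nth] returns the measurable default [setT], so no bound on [i] is required. *)
Definition measurable_seq l := forall i, measurable (nth setT l i).

Lemma measurable_seq_cons C l :
  measurable_seq (C :: l) <-> measurable C /\ measurable_seq l.
Proof.
split=> [ml|[mC ml] [|i]]; [|exact: mC|exact: ml].
by split=> [|i]; [exact: (ml 0%N) | exact: (ml i.+1)].
Qed.

Lemma measurable_coord i : measurable_fun setT (fun w : seq_space T => w i).
Proof.
move=> _ C mC; apply: sub_sigma_algebra; exists i => //.
by exists C => //; rewrite setTI.
Qed.

Lemma measurable_left_shift : measurable_fun setT (@left_shift _ T).
Proof.
apply: (@measurability _ _ (seq_space T) (seq_space T) setT (@left_shift _ T)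
  (@cylinders _ T)) => // _ [_ [i _ [C mC <-]] <-].
by rewrite !setTI; have := @measurable_coord i.+1 measurableT C mC;
   rewrite setTI.
Qed.

Lemma measurable_coord0 C : measurable C ->
  measurable ([set w | C (w 0%N)] : set (seq_space T)).
Proof.
by move=> mC; have := @measurable_coord 0 measurableT C mC; rewrite setTI.
Qed.

Lemma measurable_preimage_shift (B : set (seq_space T)) : measurable B ->
  measurable (@left_shift _ T @^-1` B).
Proof.
by move=> mB; have := measurable_left_shift measurableT mB; rewrite setTI.
Qed.

Lemma measurable_rect l : measurable_seq l -> measurable (rect l).
Proof.
elim: l => [|C l IHl]; first by move=> _; exact: measurableT.
move=> /measurable_seq_cons[mC ml]; apply: measurableI.
  exact: measurable_coord0.
apply: measurable_preimage_shift; exact: IHl.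
Qed.

Definition rects : set (set (seq_space T)) :=
  [set S | exists2 l, measurable_seq l & S = rect l].

Lemma setI_closed_rects : setI_closed rects.
Proof.
move=> _ _ [l ml ->] [l' ml' ->]; elim: l l' ml ml' => [|C l IHl] [|C' l'].
- by exists [::] => //; rewrite setTI.
- by exists (C' :: l') => //; rewrite setTI.
- by exists (C :: l) => //; rewrite setIT.
move=> /measurable_seq_cons[mC ml] /measurable_seq_cons[mC' ml'].
have [l'' ml'' ll'] := IHl _ ml ml'.
exists (C `&` C' :: l'').
  by apply/measurable_seq_cons; split=> //; exact: measurableI.
by rewrite /= -/(rect _) -ll' preimage_setI setIACA.
Qed.

Lemma measurable_rects : @measurable _ (seq_space T) = <<s rects >>.
Proof.
apply/seteqP; split; apply: smallest_sub; try exact: smallest_sigma_algebra.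
- move=> _ [i _ [C mC <-]]; rewrite setTI; apply: sub_sigma_algebra.
  (* Padding with [i] copies of [setT] constrains coordinate [i] alone. *)
  exists (ncons i setT [:: C]).
    elim: i => [|i IHi]; apply/measurable_seq_cons; split=> //.
    by move=> i; rewrite nth_nil; exact: measurableT.
  elim: i => [|i IHi] /=; first by rewrite preimage_setT setIT.
  by rewrite -/(rect _) -IHi setTI.
- by move=> _ [l ml ->]; exact: measurable_rect.
Qed.

End Rectangles.

(** * Markov operators with a unique invariant probability *)

Section Integrals.
Set Implicit Arguments.
Unset Strict Implicit.
Local Open Scope ereal_scope.
Context {dsp : measure_display} {T : measurableType dsp} {R : realType}.
Implicit Types (m : {measure set T -> \bar R}) (f g : T -> \bar R).

Lemma integral_mrestr m (D : set T) (mD : measurable D) f :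
  measurable_fun setT f -> (forall x, 0 <= f x) ->
  \int[mrestr m mD]_x f x = \int[m]_(x in D) f x.
Proof.
move=> mf f0; rewrite -(setUv D) ge0_integral_setU //; last 3 first.
- exact: measurableC.
- by rewrite setUv.
- by apply/disj_setPS => x [].
rewrite [X in _ + X]null_set_integral ?adde0.
- by apply: eq_measure_integral => B mB BD; rewrite /= /mrestr setIidl.
- exact: measurableC.
- exact: measurable_funTS.
- by rewrite /= /mrestr setICl measure0.
Qed.

(** The difference is a.e. nonnegative with zero integral. This turns a one-sided inequality for the
    Markov operator into an a.e. equality once invariance equates the integrals. *)
Lemma le_integral_ae_eq m f g :
  m.-integrable setT f -> m.-integrable setT g ->
  {ae m, forall x, f x <= g x} -> \int[m]_x f x = \int[m]_x g x ->
  {ae m, forall x, f x = g x}.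
Proof.
move=> fi gi fg fgE.
have mf := measurable_int _ fi; have mg := measurable_int _ gi.
have mgf : measurable_fun setT (g \- f) by exact: emeasurable_funB.
have fin_f := integrable_ae measurableT fi.
have fin_g := integrable_ae measurableT gi.
have /(ae_eq_integral_abs m measurableT mgf).1 gf0 :
    \int[m]_x `|(g \- f) x| = 0.
  rewrite (ae_eq_integral (g \- f)) //; last 2 first.
  - exact: measurableT_comp.
  - apply: filterS2 fg fin_f => x fgx /(_ I) fx _ /=.
    by rewrite gee0_abs// sube_ge0// fx.
  rewrite integralB// fgE subee//; exact: integrable_fin_num.
apply: filterS3 gf0 fin_f fin_g => x /(_ I) /= gf /(_ I) fx /(_ I) gx.
by rewrite -(subeK (g x) fx) gf add0e.
Qed.

Lemma bounded_integrable (P : probability T R) f (b : R) :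
  measurable_fun setT f -> (forall x, 0 <= f x <= b%:E) ->
  P.-integrable setT f.
Proof.
move=> mf fb; apply: (le_integrable measurableT mf _
  (finite_measure_integrable_cst P b measurableT)) => x _ /=.
have /andP[f0 fb'] := fb x.
by rewrite gee0_abs// (le_trans fb')// lee_fin ler_norm.
Qed.

End Integrals.

Section Transition.
Set Implicit Arguments.
Unset Strict Implicit.
Local Open Scope ereal_scope.
Context {d1 d2 : measure_display} {X : measurableType d1}
  {A : measurableType d2} {R : realType}.
Variables (mu : {sigma_finite_measure set A -> \bar R}).
Variables (phi : X * A -> X) (q : X * A -> R).
Hypothesis mphi : measurable_fun setT phi.
Hypothesis mq : measurable_fun setT q.
Hypothesis q_ge0 : forall z, (0 <= q z)%R.
Hypothesis q_mass : forall x, \int[mu]_a (q (x, a))%:E = 1.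
Implicit Types (C : set A) (f : X -> \bar R) (x : X).

(** For [C = setT] this is the Markov operator; a general [C] restricts the letter used in the step,
    as cylinders require. *)
Definition trans C f x := \int[mu]_(a in C) (f (phi (x, a)) * (q (x, a))%:E).

Lemma measurable_trans_integrand f : measurable_fun setT f ->
  measurable_fun setT (fun z => f (phi z) * (q z)%:E).
Proof.
move=> mf; apply: emeasurable_funM; first exact: measurableT_comp.
exact/measurable_EFinP.
Qed.

Lemma measurable_trans_section f x : measurable_fun setT f ->
  measurable_fun setT (fun a => f (phi (x, a)) * (q (x, a))%:E).
Proof.
move=> /measurable_trans_integrand mf.
exact: (measurableT_comp mf (pair1_measurable x)).
Qed.

Lemma trans_integrand_ge0 f z : (forall x, 0 <= f x) ->
  0 <= f (phi z) * (q z)%:E.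
Proof. by move=> f0; rewrite mule_ge0 ?f0// lee_fin. Qed.

Lemma trans_ge0 C f x : (forall x, 0 <= f x) -> 0 <= trans C f x.
Proof.
by move=> f0; apply: integral_ge0 => a _; exact: trans_integrand_ge0.
Qed.

Lemma measurable_trans C f : measurable C -> measurable_fun setT f ->
  (forall x, 0 <= f x) -> measurable_fun setT (trans C f).
Proof.
move=> mC mf f0.
(* Moving [C] into the integrand gives a function on the product, to which Tonelli applies;
   sigma-finiteness of [mu] enters here. *)
pose F z := f (phi z) * (q z)%:E * (\1_C z.2)%:E.
have mF : measurable_fun setT F.
  apply: emeasurable_funM; first exact: measurable_trans_integrand.
  exact/measurable_EFinP/(measurableT_comp (measurable_indic mC)).
rewrite (_ : trans C f = fubini_F mu F).
  apply: measurable_fun_fubini_tonelli_F => // z.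
  by rewrite /F mule_ge0 ?lee_fin//; exact: trans_integrand_ge0.
apply/funext => x; rewrite /trans integral_mkcond; apply: eq_integral => a _.
by rewrite /F patchE indicE /=; case: (a \in C); rewrite ?mule1 ?mule0.
Qed.

Lemma transD C f g x : measurable C ->
  measurable_fun setT f -> measurable_fun setT g ->
  (forall x, 0 <= f x) -> (forall x, 0 <= g x) ->
  trans C (fun y => f y + g y) x = trans C f x + trans C g x.
Proof.
move=> mC mf mg f0 g0; rewrite /trans -ge0_integralD//.
- apply: eq_integral => a _; rewrite ge0_muleDl//.
- by move=> a _; exact: trans_integrand_ge0.
- exact/measurable_funTS/measurable_trans_section.
- by move=> a _; exact: trans_integrand_ge0.
- exact/measurable_funTS/measurable_trans_section.
Qed.

Lemma transZ C f (c : R) x : measurable C -> measurable_fun setT f ->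
  (forall x, 0 <= f x) -> (0 <= c)%R ->
  trans C (fun y => c%:E * f y) x = c%:E * trans C f x.
Proof.
move=> mC mf f0 c0; rewrite /trans -ge0_integralZl//.
- by apply: eq_integral => a _; rewrite muleA.
- exact/measurable_funTS/measurable_trans_section.
- by move=> a _; exact: trans_integrand_ge0.
Qed.

Lemma trans_mono C f g x : measurable C ->
  measurable_fun setT f -> measurable_fun setT g ->
  (forall x, 0 <= f x) -> (forall x, f x <= g x) ->
  trans C f x <= trans C g x.
Proof.
move=> mC mf mg f0 fg; apply: ge0_le_integral => //.
- by move=> a _; exact: trans_integrand_ge0.
- exact/measurable_funTS/measurable_trans_section.
- exact/measurable_funTS/measurable_trans_section.
- by move=> a _; rewrite lee_wpmul2r// lee_fin.
Qed.

Lemma trans_cst (c : R) x : (0 <= c)%R -> trans setT (fun=> c%:E) x = c%:E.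
Proof.
move=> c0; rewrite /trans ge0_integralZl ?q_mass ?mule1//.
- exact/measurable_EFinP/(measurableT_comp mq (pair1_measurable x)).
- by move=> a _; rewrite lee_fin.
Qed.

Lemma trans_le C f (c : R) x : measurable C -> measurable_fun setT f ->
  (forall x, 0 <= f x <= c%:E) -> trans C f x <= c%:E.
Proof.
move=> mC mf fc; have f0 y : 0 <= f y by case/andP: (fc y).
have c0 : (0 <= c)%R.
  by have /andP[h1 h2] := fc x; rewrite -lee_fin (le_trans h1).
rewrite -(@trans_cst c x c0); apply: (@le_trans _ _ (trans setT f x)).
  apply: ge0_subset_integral => //.
  - exact: measurable_trans_section.
  - by move=> a _; exact: trans_integrand_ge0.
by apply: trans_mono => // y; case/andP: (fc y).
Qed.

Lemma trans_nneseries C (f : nat -> X -> \bar R) x : measurable C ->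
  (forall n, measurable_fun setT (f n)) -> (forall n x, 0 <= f n x) ->
  trans C (fun y => \sum_(n <oo) f n y) x = \sum_(n <oo) trans C (f n) x.
Proof.
move=> mC mf f0; rewrite /trans -integral_nneseries//.
- apply: eq_integral => a _; rewrite muleC -nneseriesZl//.
  by apply: eq_eseriesr => n _; rewrite muleC.
- by move=> n; exact/measurable_funTS/measurable_trans_section.
- by move=> n a _; exact: trans_integrand_ge0.
Qed.

(** If [trans setT f x = 0], almost every letter either leads to a zero of [f] or has weight zero,
    so only the values on the zeros of [f] count. Typically [f] is the indicator of a set not
    reached from [x]. *)
Lemma eq_trans C f g1 g2 x : measurable C ->
  measurable_fun setT f -> measurable_fun setT g1 -> measurable_fun setT g2 ->
  (forall x, 0 <= f x) ->
  (forall x, f x = 0 -> g1 x = g2 x) ->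
  trans setT f x = 0 -> trans C g1 x = trans C g2 x.
Proof.
move=> mC mf mg1 mg2 f0 fg tf.
have : ae_eq mu setT (fun a => f (phi (x, a)) * (q (x, a))%:E) (cst 0).
  apply/ae_eq_integral_abs => //; first exact: measurable_trans_section.
  rewrite -tf; apply: eq_integral => a _.
  by rewrite gee0_abs//; exact: trans_integrand_ge0.
move=> tf0; apply: ae_eq_integral => //.
- exact/measurable_funTS/measurable_trans_section.
- exact/measurable_funTS/measurable_trans_section.
apply: filterS tf0 => a /(_ I) /= /eqP; rewrite mule_eq0 => /orP[|]/eqP fa _.
  by rewrite fg.
by rewrite fa !mule0.
Qed.

Lemma trans_eq0 C f g x : measurable C ->
  measurable_fun setT f -> measurable_fun setT g ->
  (forall x, 0 <= f x) -> (forall x, f x = 0 -> g x = 0) ->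
  trans setT f x = 0 -> trans C g x = 0.
Proof.
move=> mC mf mg f0 fg tf; rewrite (@eq_trans _ f g (cst 0))//.
by apply: integral0_eq => a _; rewrite mul0e.
Qed.

(** Nonnegative test functions suit Tonelli and the bound keeps the integrals finite; signed
    functions are recovered by adding a constant. *)
Definition trans_invariant (P : probability X R) := forall (f : X -> R) (b : R),
  measurable_fun setT f -> (forall x, 0 <= f x <= b)%R ->
  \int[P]_x trans setT (EFin \o f) x = \int[P]_x (f x)%:E.

Variable eta : probability X R.
Hypothesis eta_invariant : trans_invariant eta.
Hypothesis eta_unique : forall P : probability X R, trans_invariant P ->
  forall B, measurable B -> P B = eta B.

Lemma integrable_trans C (f : X -> R) (b : R) : measurable C ->
  measurable_fun setT f -> (forall x, 0 <= f x <= b)%R ->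
  eta.-integrable setT (trans C (EFin \o f)).
Proof.
move=> mC mf fb; have mf' : measurable_fun setT (EFin \o f).
  exact/measurable_EFinP.
have f0 x : 0 <= (f x)%:E by rewrite lee_fin; case/andP: (fb x).
apply: (@bounded_integrable _ _ _ _ _ b) => [|x].
  exact: measurable_trans.
rewrite trans_ge0//= trans_le//.
Qed.

Lemma integrable_bounded_fun (f : X -> R) (b : R) :
  measurable_fun setT f -> (forall x, 0 <= f x <= b)%R ->
  eta.-integrable setT (EFin \o f).
Proof.
move=> mf fb; apply: (@bounded_integrable _ _ _ _ _ b).
  exact/measurable_EFinP.
by move=> x; rewrite !lee_fin.
Qed.

(* By invariance of [eta], a set that cannot be entered cannot be left either,
   so that [eta] conditioned on it is again invariant. *)
Lemma invariant_set01 (L : set X) : measurable L ->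
  {ae eta, forall x, ~ L x -> trans setT (EFin \o (\1_L : X -> R)) x = 0} ->
  eta L = 0 \/ eta L = 1.
Proof.
move=> mL Lout.
have [L0|L0] := eqVneq (eta L) 0; [by left | right].
have mi : measurable_fun setT (\1_L : X -> R) by exact: measurable_indic.
have mi' : measurable_fun setT (EFin \o (\1_L : X -> R) : X -> \bar R).
  exact/measurable_EFinP.
have i0 x : 0 <= (EFin \o (\1_L : X -> R)) x by rewrite lee_fin.
have i1 x : (0 <= (\1_L x : R) <= 1)%R.
  by rewrite indicE; case: (_ \in _); rewrite ?lexx ?ler01.
have i1' x : 0 <= (EFin \o (\1_L : X -> R)) x <= 1%:E.
  by rewrite !lee_fin; exact: i1.
(* One inequality holds a.e.: off [L] by hypothesis, on [L] because the kernel has mass one.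
   Invariance equates the integrals. *)
have iL : {ae eta, forall x,
    trans setT (EFin \o (\1_L : X -> R)) x = (\1_L x)%:E}.
  apply: (le_integral_ae_eq (integrable_trans measurableT mi i1)).
  - exact: integrable_bounded_fun i1.
  - apply: filterS Lout => x Lx; have [xL|xL] := pselect (L x).
      by rewrite indicE mem_set// trans_le.
    by rewrite Lx ?lee_fin.
  - exact: eta_invariant i1.
have miC : measurable_fun setT (EFin \o (\1_(~` L) : X -> R)).
  exact/measurable_EFinP/measurable_indic/measurableC.
have iC0 x : 0 <= (EFin \o (\1_(~` L) : X -> R)) x by rewrite lee_fin.
have Lin : {ae eta, forall x, L x ->
    trans setT (EFin \o (\1_(~` L) : X -> R)) x = 0}.
  apply: filterS iL => x xiL Lx.
  have := @trans_cst 1%R x ler01.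
  rewrite (_ : (fun=> 1%:E) = fun y => (EFin \o (\1_L : X -> R)) y +
      (EFin \o (\1_(~` L) : X -> R)) y); last first.
    apply/funext => y; rewrite /= -EFinD !indicE in_setC.
    by case: (y \in L); rewrite ?addr0 ?add0r.
  rewrite transD// ?xiL.
  rewrite indicE mem_set// => /(congr1 (fun z => z - 1%:E)).
  by rewrite addeAC subee// add0e.
have fin_etaL : eta L \is a fin_num by exact: fin_num_measure.
(* This is [eta] conditioned on [L]; the last argument is only the fallback for a degenerate total
   mass. *)
pose P : probability X R := mnormalize (mrestr eta mL) eta.
have PE B : measurable B -> P B = eta (B `&` L) * (fine (eta L))^-1%:E.
  move=> mB; rewrite /P /= /mnormalize /= /mrestr setTI (negbTE L0) /=.
  by rewrite lt_eqF// ltey_eq fin_etaL.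
have k0 : (0 <= (fine (eta L))^-1)%R by rewrite invr_ge0 fine_ge0.
have intP (f : X -> \bar R) : measurable_fun setT f -> (forall x, 0 <= f x) ->
    \int[P]_x f x = (fine (eta L))^-1%:E * \int[eta]_(x in L) f x.
  move=> mf f0.
  rewrite (eq_measure_integral (mscale (NngNum k0) (mrestr eta mL))).
    by rewrite ge0_integral_mscale//= integral_mrestr.
  by move=> B mB _; rewrite [LHS]PE// muleC.
have Pinv : trans_invariant P.
  move=> f b mf fb.
  have f0 x : 0 <= (EFin \o f) x by rewrite lee_fin; case/andP: (fb x).
  have mf' : measurable_fun setT (EFin \o f) by exact/measurable_EFinP.
  have mT : measurable_fun setT (trans setT (EFin \o f)).
    exact: measurable_trans.
  have T0 x : 0 <= trans setT (EFin \o f) x by exact: trans_ge0.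
  rewrite !intP//; congr (_ * _).
  (* As a.e. no step crosses the boundary of [L], cutting [trans setT f] off to [L] gives
     [trans setT g] a.e., and invariance of [eta] is applied to [g]. *)
  pose g y := (f y * \1_L y)%R.
  have mg : measurable_fun setT g by exact: measurable_funM.
  have gb x : (0 <= g x <= b)%R.
    have /andP[fx0 fxb] := fb x.
    rewrite /g indicE; case: (_ \in _); rewrite ?mulr1 ?mulr0 ?fx0//.
    by rewrite lexx (le_trans fx0).
  have mg' : measurable_fun setT (EFin \o g) by exact/measurable_EFinP.
  have g0 x : 0 <= (EFin \o g) x by rewrite lee_fin; case/andP: (gb x).
  transitivity (\int[eta]_x trans setT (EFin \o g) x); last first.
    rewrite (eta_invariant mg gb) [RHS]integral_mkcond.
    apply: eq_integral => x _; rewrite patchE /g indicE.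
    by case: (_ \in _); rewrite ?mulr1 ?mulr0.
  rewrite integral_mkcond; apply: ge0_ae_eq_integral => //.
  - by apply/(measurable_restrictT _ mL).1/measurable_funTS.
  - exact: measurable_trans.
  - by move=> x _; rewrite patchE; case: ifP.
  - by move=> x _; exact: trans_ge0.
  apply: filterS2 Lout Lin => x xout xin _; rewrite patchE.
  have [xL|xL] := pselect (L x).
    rewrite mem_set//; pose g' y := (f y * \1_(~` L) y)%R.
    have mg'' : measurable_fun setT (EFin \o g').
      by apply/measurable_EFinP/measurable_funM => //;
         exact/measurable_indic/measurableC.
    have g'0 y : 0 <= (EFin \o g') y.
      by rewrite lee_fin mulr_ge0//; case/andP: (fb y).
    rewrite (_ : EFin \o f = fun y => (EFin \o g) y + (EFin \o g') y).
      rewrite transD// [X in _ + X](@trans_eq0 _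
        (EFin \o (\1_(~` L) : X -> R))) ?adde0 ?xin//.
      by move=> y /= [] iy; rewrite /g' iy mulr0.
    apply/funext => y; rewrite /g /g' /= -EFinD !indicE in_setC -mulrDr.
    by case: (y \in L); rewrite ?addr0 ?add0r mulr1.
  rewrite memNset//; apply/esym.
  apply: (@trans_eq0 _ (EFin \o (\1_L : X -> R))) => //; last exact: xout.
  by move=> y /= [] iy; rewrite /g iy mulr0.
rewrite -(eta_unique Pinv mL) PE// setIid -[X in X * _]fineK//.
by rewrite -EFinM divff// fine_eq0.
Qed.

Lemma harmonic_ae_const (h : X -> R) : measurable_fun setT h ->
  (forall x, 0 <= h x <= 1)%R ->
  (forall x, trans setT (EFin \o h) x = (h x)%:E) ->
  exists2 c : R, (0 <= c)%R & {ae eta, forall x, h x = c}.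
Proof.
move=> mh h01 hh.
have h0 x : (0 <= h x)%R by case/andP: (h01 x).
have h1 x : (h x <= 1)%R by case/andP: (h01 x).
have hi := integrable_bounded_fun mh h01.
pose c := fine (\int[eta]_x (h x)%:E).
have cE : \int[eta]_x (h x)%:E = c%:E.
  by rewrite /c fineK//; exact: integrable_fin_num hi.
have c0 : (0 <= c)%R.
  by rewrite -lee_fin -cE integral_ge0// => x _; rewrite lee_fin.
have ci : eta.-integrable setT (EFin \o cst c).
  exact: finite_measure_integrable_cst.
have intc : \int[eta]_x (EFin \o cst c) x = c%:E.
  by rewrite /= integral_cst// [X in _ * X]probability_setT mule1.
pose G x := Num.max (h x - c)%R 0%R.
have mG : measurable_fun setT G.
  by apply: measurable_funrpos; exact: measurable_funB.
have G01 x : (0 <= G x <= 1)%R.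
  rewrite /G le_max lexx orbT ge_max ler01 andbT.
  by rewrite lerBlDr (le_trans (h1 x))// lerDl.
have mG' : measurable_fun setT (EFin \o G) by exact/measurable_EFinP.
have mh' : measurable_fun setT (EFin \o h) by exact/measurable_EFinP.
have G0 x : 0 <= (EFin \o G) x by rewrite lee_fin; case/andP: (G01 x).
(* Apply the operator to [h <= G + c]: it fixes both [h] and constants. *)
have GT x : (G x)%:E <= trans setT (EFin \o G) x.
  rewrite /G EFin_max ge_max trans_ge0// andbT EFinB leeBlDr//.
  rewrite -hh -(@trans_cst c x c0) -transD//; apply: trans_mono => //.
  - exact: emeasurable_funD.
  - by move=> y; rewrite lee_fin -lerBlDr le_max lexx.
have TG : {ae eta, forall x, (G x)%:E = trans setT (EFin \o G) x}.
  apply: le_integral_ae_eq.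
  - exact: integrable_bounded_fun G01.
  - exact: integrable_trans G01.
  - exact: aeW.
  - by rewrite (eta_invariant mG G01).
pose L := [set x | (c < h x)%R].
have mL : measurable L.
  by rewrite -[L]setTI; apply: measurable_fun_ltr.
(* Off [L] the function [G] vanishes, hence a.e. so does [trans setT G]; as [G] is positive on [L],
   no step from there enters [L]. *)
have Lout : {ae eta, forall x, ~ L x ->
    trans setT (EFin \o (\1_L : X -> R)) x = 0}.
  apply: filterS TG => x TGx Lx.
  apply: (@trans_eq0 _ (EFin \o G)) => //.
  - exact/measurable_EFinP/measurable_indic.
  - move=> y [Gy]; rewrite /= indicE memNset// /L /= => cy.
    by move: Gy; rewrite /G max_l ?subr_ge0 ?ltW// => /eqP;
       rewrite subr_eq0 gt_eqF.
  - rewrite -TGx /G max_r// subr_le0 leNgt; exact/negP.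
(* In both cases [h] lies a.e. on one side of its own mean, which forces equality. *)
have [L0|L1] := invariant_set01 mL Lout; exists c => //.
- suff : {ae eta, forall x, (EFin \o h) x = (EFin \o cst c) x}.
    by apply: filterS => x [].
  apply: le_integral_ae_eq => //; last by rewrite intc.
  exists L; split => // x /= /negP; rewrite lee_fin -ltNge.
  by [].
- suff : {ae eta, forall x, (EFin \o cst c) x = (EFin \o h) x}.
    by apply: filterS => x [].
  apply: le_integral_ae_eq => //; last by rewrite intc.
  exists (~` L); split; first exact: measurableC.
    by rewrite [LHS]probability_setC// L1 subee.
  move=> x /= /negP; rewrite lee_fin -ltNge => hc; rewrite /L /=.
  by move=> /(lt_trans hc); rewrite ltxx.
Qed.

(** * Path measures, the Markov property and ergodicity of the shift *)

Variable Qx : X -> probability (seq_space A) R.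
Hypothesis Qx_rect : forall C l x, measurable C -> measurable_seq l ->
  Qx x (rect (C :: l)) = trans C (fun y => Qx y (rect l)) x.

Lemma measurable_Qx_rect l : measurable_seq l ->
  measurable_fun setT (fun x => Qx x (rect l)).
Proof.
elim: l => [_|C l IHl /measurable_seq_cons[mC ml]].
  rewrite (_ : (fun x => _) = cst 1); first exact: measurable_cst.
  by apply/funext => x; rewrite /rect /= probability_setT.
rewrite (_ : (fun x => _) = trans C (fun y => Qx y (rect l))).
  by apply: measurable_trans => //; exact: IHl.
by apply/funext => x; rewrite Qx_rect.
Qed.

Lemma Qx_coord0 C x : measurable C ->
  Qx x [set w | C (w 0%N)] = trans C (fun=> 1) x.
Proof.
move=> mC; rewrite -(setIT [set w | _]).
have -> : [set w | C (w 0%N)] `&` setT = rect [:: C].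
  by rewrite /= preimage_setT.
rewrite Qx_rect//; last by move=> i; rewrite nth_nil; exact: measurableT.
by congr trans; apply/funext => y; rewrite /rect /= probability_setT.
Qed.

(** The two claims share one Dynkin induction: complements and disjoint unions use additivity of
    [trans], which asks for measurability in the starting point. *)
Lemma Qx_markov (B : set (seq_space A)) : measurable B ->
  measurable_fun setT (fun x => Qx x B) /\
  forall C x, measurable C ->
    Qx x ([set w | C (w 0%N)] `&` @left_shift _ A @^-1` B) =
    trans C (fun y => Qx y B) x.
Proof.
have -> : measurable B = <<s rects >> B by rewrite -measurable_rects.
move: B; apply: (dynkin_induction measurable_rects).
- exact: setI_closed_rects.
- split=> [|C x mC].
    rewrite (_ : (fun x => _) = cst 1); first exact: measurable_cst.
    by apply/funext => x; rewrite probability_setT.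
  rewrite preimage_setT setIT Qx_coord0//.
  by congr trans; apply/funext => y; rewrite probability_setT.
- move=> _ [l ml ->]; split; first exact: measurable_Qx_rect.
  by move=> C x mC; rewrite -Qx_rect.
- move=> S mS [mQ QS].
  have QC y : Qx y (~` S) = 1 - Qx y S by rewrite probability_setC.
  split=> [|C x mC].
    by under eq_fun do rewrite QC; exact: emeasurable_funB.
  have mS' := measurable_preimage_shift mS.
  have : Qx x [set w | C (w 0%N)] =
      Qx x ([set w | C (w 0%N)] `&` @left_shift _ A @^-1` (~` S)) +
      Qx x ([set w | C (w 0%N)] `&` @left_shift _ A @^-1` S).
    rewrite preimage_setC -setDE.
    exact: measureDI (measurable_coord0 mC) mS'.
  rewrite QS//.
  rewrite Qx_coord0// (_ : (fun=> 1) = fun y => Qx y S + Qx y (~` S)).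
    rewrite transD//; last first.
      by under eq_fun do rewrite QC; exact: emeasurable_funB.
    move=> /(congr1 (fun z => z - trans C (fun y => Qx y S) x)).
    have fS : trans C (fun y => Qx y S) x \is a fin_num.
      by rewrite -QS// fin_num_measure//; apply: measurableI => //;
         exact: measurable_coord0.
    by rewrite addeAC subee// add0e addeK.
  by apply/funext => y; rewrite QC addeC subeK// fin_num_measure.
- move=> F mF tF QF.
  have mUF : measurable (\bigcup_k F k) by exact: bigcupT_measurable.
  have QF_sum y : Qx y (\bigcup_k F k) = \sum_(n <oo) Qx y (F n).
    exact: measure_semi_bigcup.
  split=> [|C x mC].
    under eq_fun do rewrite QF_sum.
    by apply: ge0_emeasurable_sum => // n _; exact: (QF n).1.
  have mI n : measurable
      ([set w | C (w 0%N)] `&` @left_shift _ A @^-1` F n : set (seq_space A)).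
    by apply: measurableI;
       [exact: measurable_coord0|exact: measurable_preimage_shift].
  rewrite preimage_bigcup setI_bigcupr measure_semi_bigcup//.
  - under [in RHS]eq_fun do rewrite QF_sum.
    rewrite trans_nneseries// => [|n]; last exact: (QF n).1.
    by apply: eq_eseriesr => n _; exact: (QF n).2.
  - apply: trivIset_setIl => i j Ii Ij [w [Fi Fj]].
    by apply: (tF i j Ii Ij); exists (left_shift w).
  - exact: bigcupT_measurable.
Qed.

Variable Q : probability (seq_space A) R.
Hypothesis Q_mixture : forall B, measurable B -> Q B = \int[eta]_x Qx x B.

Lemma trans_Qx_shift B x : measurable B ->
  Qx x (@left_shift _ A @^-1` B) = trans setT (fun y => Qx y B) x.
Proof.
by move=> mB; rewrite -(Qx_markov mB).2//; congr (Qx x _); rewrite setTI.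
Qed.

Lemma int_trans_Qx B : measurable B ->
  \int[eta]_x trans setT (fun y => Qx y B) x = Q B.
Proof.
move=> mB; rewrite Q_mixture//.
pose h y := fine (Qx y B).
have hE y : Qx y B = (h y)%:E by rewrite /h fineK// fin_num_measure.
have -> : (fun y => Qx y B) = EFin \o h by apply/funext.
rewrite (@eta_invariant h 1%R).
- by [].
- apply/measurable_EFinP; rewrite (_ : _ \o _ = fun y => Qx y B).
    exact: (Qx_markov mB).1.
  by apply/funext => y /=; rewrite hE.
- by move=> x; rewrite -!lee_fin -hE measure_ge0 probability_le1.
Qed.

(* An invariant event is independent of every cylinder, hence of itself. *)
Lemma shift_ergodic : ergodic Q (@left_shift _ A).
Proof.
have Qshift B : measurable B -> Q (@left_shift _ A @^-1` B) = Q B.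
  move=> mB; rewrite -(int_trans_Qx mB) Q_mixture.
    by apply: eq_integral => x _; rewrite trans_Qx_shift.
  exact: measurable_preimage_shift.
split=> // B mB Binv.
pose h x := fine (Qx x B).
have hE x : Qx x B = (h x)%:E by rewrite /h fineK// fin_num_measure.
have mh : measurable_fun setT h.
  apply/measurable_EFinP; rewrite (_ : _ \o _ = fun y => Qx y B).
    exact: (Qx_markov mB).1.
  by apply/funext => y /=; rewrite hE.
(* [Binv] is an equality of sets, so [h] is harmonic at every starting point. *)
have [c c0 hc] : exists2 c : R, (0 <= c)%R & {ae eta, forall x, h x = c}.
  apply: harmonic_ae_const => // x.
    by rewrite -!lee_fin -hE measure_ge0 probability_le1.
  rewrite -hE -[in RHS]Binv trans_Qx_shift//; congr trans; exact/funext.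
have mBS S : measurable S -> measurable (B `&` S) by exact: measurableI.
have key l : measurable_seq l ->
    {ae eta, forall x, Qx x (B `&` rect l) = c%:E * Qx x (rect l)}.
  elim: l => [_|C l IHl /measurable_seq_cons[mC ml]].
    apply: filterS hc => x hx.
    by rewrite /rect /= setIT probability_setT mule1 hE hx.
  have mQl := measurable_Qx_rect ml.
  have mQBl := (Qx_markov (mBS _ (measurable_rect ml))).1.
  have [N [mN etaN0 subN]] := IHl ml.
  have miN : measurable_fun setT (\1_N : X -> R) by exact: measurable_indic.
  have iN01 x : (0 <= (\1_N x : R) <= 1)%R.
    by rewrite indicE; case: (_ \in _); rewrite ?lexx ?ler01.
  (* [N] contains the exceptional points for [l]. By invariance, from a.e. [x] the first step avoids
     [N], so the induction hypothesis can be used after that step. *)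
  have : ae_eq eta setT (trans setT (EFin \o (\1_N : X -> R))) (cst 0).
    apply/ae_eq_integral_abs => //.
      apply: measurable_trans => //; first exact/measurable_EFinP.
      by move=> x; rewrite lee_fin; case/andP: (iN01 x).
    transitivity (\int[eta]_x trans setT (EFin \o (\1_N : X -> R)) x).
      apply: eq_integral => x _; rewrite gee0_abs// trans_ge0// => y.
      by rewrite lee_fin; case/andP: (iN01 y).
    by rewrite (eta_invariant miN iN01) integral_indic// setIT.
  apply: filterS => x /(_ I) /= xN.
  (* Replacing [B] by its preimage puts the whole event, apart from the first letter, behind one
     shift. *)
  have -> : B `&` rect (C :: l) =
      [set w | C (w 0%N)] `&` @left_shift _ A @^-1` (B `&` rect l).
    by rewrite preimage_setI Binv setICA.
  rewrite (Qx_markov (mBS _ (measurable_rect ml))).2// Qx_rect// -transZ//.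
  apply: (@eq_trans _ (EFin \o (\1_N : X -> R))) => //.
  - exact/measurable_EFinP.
  - exact: measurable_funeM.
  - by move=> y; rewrite lee_fin; case/andP: (iN01 y).
  - move=> y [] /eqP; rewrite indicE; have [yN|yN] := boolP (y \in N).
      by rewrite oner_eq0.
    move=> _; apply: contrapT => ne; move/negP: yN; apply.
    by rewrite inE; exact: subN.
have Qrect l : measurable_seq l -> Q (B `&` rect l) = c%:E * Q (rect l).
  move=> ml; have mr := measurable_rect ml.
  rewrite !Q_mixture//; last exact: mBS.
  rewrite -ge0_integralZl//; last exact: (Qx_markov mr).1.
  apply: ae_eq_integral => //.
  - exact: (Qx_markov (mBS _ mr)).1.
  - by apply: measurable_funeM; exact: (Qx_markov mr).1.
  - by apply: filterS (key l ml) => x.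
have QB : Q B = c%:E.
  have := Qrect [::]; rewrite /rect /= setIT probability_setT mule1.
  by apply => i; rewrite nth_nil; exact: measurableT.
(* Dynkin induction extends independence from rectangles to all events; [S := B] then yields c =
   c^2. *)
have QI S : measurable S -> Q (B `&` S) = c%:E * Q S.
  have -> : measurable S = <<s rects >> S by rewrite -measurable_rects.
  move: S; apply: (dynkin_induction measurable_rects).
  - exact: setI_closed_rects.
  - by rewrite setIT probability_setT mule1.
  - by move=> _ [l ml ->]; exact: Qrect.
  - move=> S mS QS.
    have : Q B = Q (B `&` ~` S) + Q (B `&` S).
      by rewrite -setDE; exact: measureDI.
    have fQ D : measurable D -> Q D = (fine (Q D))%:E.
      by move=> mD; rewrite fineK// fin_num_measure.
    rewrite QS probability_setC// QB (fQ _ mS) (fQ (B `&` ~` S)).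
      rewrite -EFinB -!EFinM -EFinD => -[] cE; congr EFin.
      by rewrite mulrBr mulr1 {1}cE addrK.
    by apply: mBS; exact: measurableC.
  - move=> F mF tF QF; rewrite setI_bigcupr !measure_semi_bigcup//.
    + by rewrite -nneseriesZl//; apply: eq_eseriesr => n _; exact: QF.
    + exact: bigcupT_measurable.
    + by move=> n; exact: mBS.
    + exact: trivIset_setIl.
    + by apply: bigcupT_measurable => n; exact: mBS.
have : c%:E = c%:E * c%:E by rewrite -{1}QB -{2}QB -QI// setIid.
rewrite -EFinM => -[] /eqP; rewrite -{1}[c]mulr1 -subr_eq0 -mulrBr.
rewrite mulf_eq0 subr_eq0 => /orP[] /eqP cE.
  by left; rewrite QB cE.
by right; rewrite QB -cE.
Qed.

End Transition.

(** * Measurability of the projective action *)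

Section ProjectiveAction.
Set Implicit Arguments.
Unset Strict Implicit.
Context {R : realType} {d : nat}.
Local Notation C := (Cx R).
Implicit Types (L M : proj_space R d) (w : 'M[C]_d.+1) (y z : 'cV[C]_d.+1).

Lemma sqr_normcE (z : C) : Normc.normc z ^+ 2 = complex.Re (z * z^*).
Proof.
apply: (@complexI R); rewrite rmorphXn /= -normCE normCK.
by apply/esym/RRe_real; rewrite -normCK realX// normr_real.
Qed.

Lemma val_pact w L : w *m urep L != 0 -> val (pact w L) = <[w *m urep L]>%VS.
Proof. by move=> wL; rewrite val_insubd dim_vline wL. Qed.

(** A spanning vector determines the chosen representative only up to a scalar of known modulus;
    norms and moduli of [hdot] do not see its phase. *)
Lemma urep_scale M z : val M = <[z]>%VS ->
  exists2 c : C, z = c *: urep M & Normc.normc c = l2norm z.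
Proof.
move=> Mz; have : z \in val M by rewrite Mz memv_line.
rewrite proj_urep => /vlineP[c ->]; exists c => //.
by rewrite l2normZ l2norm_urep mulr1.
Qed.

Lemma l2norm_mul_urep M z w : val M = <[z]>%VS ->
  l2norm (w *m z) = l2norm (w *m urep M) * l2norm z.
Proof.
move=> /urep_scale[c zE <-].
by rewrite zE -scalemxAr l2normZ mulrC.
Qed.

Lemma normc_hdot_urep M z y : val M = <[z]>%VS ->
  Normc.normc (hdot z y) = l2norm z * Normc.normc (hdot (urep M) y).
Proof. by move=> /urep_scale[c zE <-]; rewrite zE hdotZl Normc.normcM. Qed.

Lemma l2norm_eq0 z : (l2norm z == 0) = (z == 0).
Proof.
apply/eqP/eqP => [/l2norm0_eq0//|->].
by rewrite -(scale0r 0) l2normZ Normc.normc0 mul0r.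
Qed.

(** The hypothesis excludes the junk value of [pact]; both sides are then spanned by proportional
    nonzero vectors. *)
Lemma pact_mul w1 w2 L : w1 *m w2 *m urep L != 0 ->
  pact (w1 *m w2) L = pact w1 (pact w2 L).
Proof.
move=> w12; have w2L : w2 *m urep L != 0.
  by apply: contra w12 => /eqP w0; rewrite -mulmxA w0 mulmx0.
have [c cE _] := urep_scale (val_pact w2L).
have c0 : c != 0 by apply: contra w2L => /eqP c0; rewrite cE c0 scale0r.
have w1M : w1 *m urep (pact w2 L) != 0.
  apply: contra w12 => /eqP w0.
  by rewrite -mulmxA cE -scalemxAr w0 scaler0.
have E := val_pact w12; rewrite -[in RHS]mulmxA cE -scalemxAr in E.
apply: val_inj; rewrite [LHS]E [RHS]val_pact//.
apply/eqP; rewrite eqEdim !dim_vline scaler_eq0 (negbTE c0) w1M leqnn andbT.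
by rewrite -memvE memvZ// memv_line.
Qed.

Lemma l2norm_mul_pact w1 w2 L : w2 *m urep L != 0 ->
  l2norm (w1 *m w2 *m urep L) =
  l2norm (w1 *m urep (pact w2 L)) * l2norm (w2 *m urep L).
Proof. by move=> w2L; rewrite -mulmxA; exact/l2norm_mul_urep/val_pact. Qed.

Lemma pdist_pact w L M : w *m urep L != 0 ->
  pdist (pact w L) M = Num.sqrt (1 -
    Normc.normc (hdot (w *m urep L) (urep M)) ^+ 2 / l2norm (w *m urep L) ^+ 2).
Proof.
move=> wL; rewrite /pdist (normc_hdot_urep _ (val_pact wL)) exprMn mulrAC.
by rewrite divff ?mul1r// expf_eq0 l2norm_eq0.
Qed.

Lemma density_eq0 k (e : proj_space R d -> R) n L w (s : R) :
  s != 0 -> w *m urep L = 0 -> density s k e n L w = 0.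
Proof.
move=> s0 w0; rewrite /density w0.
have /eqP -> : l2norm (0 : 'cV[C]_d.+1) == 0 by rewrite l2norm_eq0.
by rewrite powR0 ?mulr0.
Qed.

(** Cocycle identity: the intermediate value of [e] cancels and the norms multiply along the orbit.
    If a product kills the vector, [s != 0] makes both sides zero, so the junk value of [pact] never
    counts. *)
Lemma density_mul k (e : proj_space R d -> R) n L w1 w2 (s : R) :
  s != 0 -> (forall x, e x != 0) ->
  density s k e n.+1 L (w1 *m w2) =
  density s k e 1 L w2 * density s k e n (pact w2 L) w1.
Proof.
move=> s0 e0.
have [w2L|w2L] := eqVneq (w2 *m urep L) 0.
  by rewrite density_eq0// -?mulmxA ?w2L ?mulmx0// density_eq0// mul0r.
have [w12|w12] := eqVneq (w1 *m w2 *m urep L) 0.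
  rewrite density_eq0// (@density_eq0 _ _ n)// ?mulr0//.
  have [c cE _] := urep_scale (val_pact w2L).
  have c0 : c != 0 by apply: contra w2L => /eqP c0; rewrite cE c0 scale0r.
  move/eqP: w12; rewrite -mulmxA cE -scalemxAr scaler_eq0 (negbTE c0).
  by move/eqP.
have nE := l2norm_mul_pact w1 w2L.
have pE := pact_mul w12.
rewrite /density nE pE.
set A := l2norm (w1 *m _); set B := l2norm (w2 *m _).
have A0 : 0 <= A by exact: l2norm_ge0.
have B0 : 0 <= B by exact: l2norm_ge0.
clearbody A B.
rewrite (powRM s A0 B0) expr1 exprS invfM.
set x1 := pact w2 L; set x2 := pact w1 x1.
set a := A `^ s; set b := B `^ s.
set ki := k^-1; set kn := (k ^+ n)^-1.
have e1 := e0 x1; have eL := e0 L.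
by field; rewrite e1 eL.
Qed.

End ProjectiveAction.

Section BorelMaps.
Set Implicit Arguments.
Unset Strict Implicit.
Context {R : realType}.

Lemma measurable_fun_ltlt (dsp : measure_display) (T : measurableType dsp)
    (f : T -> R) :
  (forall r, measurable [set x | r < f x]) -> measurable_fun setT f.
Proof.
move=> mf; apply: (measurability (@RGenOInfty.G R)).
  exact: RGenOInfty.measurableE.
move=> _ [_ [r ->] <-]; rewrite setTI.
rewrite (_ : _ @^-1` _ = [set x | r < f x]) //.
by apply/seteqP; split=> x /=; rewrite in_itv /= andbT.
Qed.

Lemma continuous_borel (T : ptopologicalType) (f : T -> R) : continuous f ->
  measurable_fun setT (f : borel T -> R).
Proof.
move=> /continuousP cf; apply: measurable_fun_ltlt => r.
apply: sub_sigma_algebra; rewrite (_ : [set x | _] = f @^-1` `]r, +oo[).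
  by apply: cf; exact: interval_open.
by apply/seteqP; split=> x /=; rewrite in_itv /= andbT.
Qed.

End BorelMaps.

Section ProjectiveMeasurability.
Set Implicit Arguments.
Unset Strict Implicit.
Context {R : realType} {d : nat}.
Local Notation C := (Cx R).
Local Notation P := (proj_space R d).

Lemma measurable_pdist (M : P) :
  measurable_fun setT (fun L : borel P => pdist L M).
Proof.
apply: measurable_fun_ltlt => r; apply: sub_sigma_algebra.
rewrite openE => L /= rL; apply/nbhs_ballP.
exists (pdist L M - r); first by rewrite /= subr_gt0.
move=> N; rewrite ballEmdist /= => LN.
rewrite -(ltrD2l (pdist L N)); apply: lt_le_trans (pdist_triangle N _ _).
by rewrite -ltrBrDr.
Qed.

End ProjectiveMeasurability.

Section ComplexMeasurable.
Set Implicit Arguments.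
Unset Strict Implicit.
Context {dsp : measure_display} {T : measurableType dsp} {R : realType}.
Local Notation C := (Cx R).
Implicit Types f g : T -> C.

Definition cmeasurable f := measurable_fun setT (fun x => complex.Re (f x)) /\
  measurable_fun setT (fun x => complex.Im (f x)).

Lemma cmeasurable_cst (c : C) : cmeasurable (fun=> c).
Proof. by split; exact: measurable_cst. Qed.

Lemma cmeasurableD f g : cmeasurable f -> cmeasurable g ->
  cmeasurable (fun x => f x + g x).
Proof.
move=> [rf jf] [rg jg]; split.
  rewrite (_ : (fun x => _) = (fun x => complex.Re (f x) + complex.Re (g x))).
    exact: measurable_funD.
  by apply/funext => x; rewrite raddfD.
rewrite (_ : (fun x => _) = (fun x => complex.Im (f x) + complex.Im (g x))).
  exact: measurable_funD.
by apply/funext => x; rewrite raddfD.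
Qed.

Lemma cmeasurableM f g : cmeasurable f -> cmeasurable g ->
  cmeasurable (fun x => f x * g x).
Proof.
move=> [rf jf] [rg jg]; split.
  rewrite (_ : (fun x => _) = (fun x => complex.Re (f x) * complex.Re (g x) -
      complex.Im (f x) * complex.Im (g x))).
    by apply: measurable_funB; exact: measurable_funM.
  by apply/funext => x; case: (f x); case: (g x).
rewrite (_ : (fun x => _) = (fun x => complex.Re (f x) * complex.Im (g x) +
    complex.Im (f x) * complex.Re (g x))).
  by apply: measurable_funD; exact: measurable_funM.
by apply/funext => x; case: (f x); case: (g x).
Qed.

Lemma cmeasurable_conj f : cmeasurable f -> cmeasurable (fun x => (f x)^*).
Proof.
move=> [rf jf]; split.
  rewrite (_ : (fun x => _) = (fun x => complex.Re (f x)))//.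
  by apply/funext => x; case: (f x).
rewrite (_ : (fun x => _) = (fun x => - complex.Im (f x))).
  exact: measurable_funN.
by apply/funext => x; case: (f x).
Qed.

Lemma cmeasurable_sum (I : Type) (s : seq I) (f : I -> T -> C) :
  (forall i, cmeasurable (f i)) -> cmeasurable (fun x => \sum_(i <- s) f i x).
Proof.
move=> mf; elim: s => [|i s IHs].
  by under eq_fun do rewrite big_nil; exact: cmeasurable_cst.
under eq_fun do rewrite big_cons; exact: cmeasurableD.
Qed.

End ComplexMeasurable.

Lemma cmeasurable_comp (R : realType) (d1 d2 : measure_display)
    (T1 : measurableType d1) (T2 : measurableType d2) (f : T2 -> Cx R)
    (g : T1 -> T2) :
  cmeasurable f -> measurable_fun setT g -> cmeasurable (f \o g).
Proof.
move=> [rf jf] mg; split; first exact: (measurableT_comp rf mg).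
exact: (measurableT_comp jf mg).
Qed.

(** * Phase-free coordinates of a line *)

Section ProjectiveCoordinates.
Set Implicit Arguments.
Unset Strict Implicit.
Context {R : realType} {d : nat}.
Local Notation C := (Cx R).
Local Notation P := (proj_space R d).

Lemma line_ex (y : 'cV[C]_d.+1) : y != 0 -> exists M : P, val M = <[y]>%VS.
Proof.
move=> y0; have y1 : \dim <[y]>%VS == 1%N by rewrite dim_vline y0.
by exists (exist (fun L : {vspace _} => \dim L == 1%N) _ y1).
Qed.

Lemma sqr_normc_hdot_urep (L M : P) :
  Normc.normc (hdot (urep L) (urep M)) ^+ 2 = 1 - pdist L M ^+ 2.
Proof.
rewrite /pdist; set n := Normc.normc _.
have n0 : 0 <= n by exact: normc_ge0.
have n1 : n <= 1.
  by rewrite -(l2norm_urep L); apply: hdot_le; exact: l2norm_urep.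
clearbody n; rewrite sqr_sqrtr ?subKr// subr_ge0.
by rewrite expr_le1.
Qed.

(** Up to a scalar, a nonzero [y] represents a line [M], and the squared modulus against [urep M] is
    1 minus the squared distance to [M], a Borel function. *)
Lemma measurable_hdot_urep (y : 'cV[C]_d.+1) :
  measurable_fun setT
    (fun L : borel P => Normc.normc (hdot (urep L) y) ^+ 2).
Proof.
have [->|y0] := eqVneq y 0.
  rewrite (_ : (fun=> _) = cst 0); first exact: measurable_cst.
  apply/funext => L; rewrite /hdot big1 ?Normc.normc0 ?expr0n// => i _.
  by rewrite mxE conjC0 mulr0.
have [M /urep_scale[c -> _]] := line_ex y0.
rewrite (_ : (fun=> _) =
    fun L : borel P => Normc.normc (c^*) ^+ 2 * (1 - pdist L M ^+ 2)).
  apply: measurable_funM; first exact: measurable_cst.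
  apply: measurable_funB; first exact: measurable_cst.
  apply: measurable_funX; exact: measurable_pdist.
by apply/funext => L; rewrite hdotZr Normc.normcM exprMn sqr_normc_hdot_urep.
Qed.

(* The products [u_i * u_j^*] are the entries of the orthogonal projection
   on the line of [u]: unlike [u], they do not depend on the representative,
   and by polarization they are combinations of the [|<u, y>|^2]. *)
Lemma cmeasurable_urep_mul (i j : 'I_d.+1) :
  cmeasurable (fun L : borel P => urep L i 0 * (urep L j 0)^*).
Proof.
pose N y (L : borel P) := Normc.normc (hdot (urep L) y) ^+ 2.
have mN y : measurable_fun setT (N y) by exact: measurable_hdot_urep.
pose b (k : 'I_d.+1) : 'cV[C]_d.+1 := delta_mx k 0.
have hb (L : P) k : hdot (urep L) (b k) = urep L k 0.
  rewrite /hdot (bigD1 k)//= big1 ?addr0 => [|l lk].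
    by rewrite mxE !eqxx conjC1 mulr1.
  by rewrite mxE (negbTE lk) conjC0 mulr0.
split.
  rewrite (_ : (fun=> _) =
      fun L => (N (b i + b j) L - N (b i) L - N (b j) L) / 2).
    apply: measurable_funM => //.
    by apply: measurable_funB => //; exact: measurable_funB.
  apply/funext => L; rewrite /N hdotDr !hb !sqr_normcE.
  case: (urep L i 0) => a a'; case: (urep L j 0) => c c' /=.
  by field.
(* [hdot] conjugates the factor i on [b j], so the cross term is -2 Im(u_i conj(u_j)); hence the
   sign. *)
rewrite (_ : (fun=> _) =
    fun L => - (N (b i + (0 +i* 1)%C *: b j) L - N (b i) L - N (b j) L) / 2).
  apply: measurable_funM => //; apply: measurable_funN.
  by apply: measurable_funB => //; exact: measurable_funB.
apply/funext => L; rewrite /N hdotDr hdotZr !hb !sqr_normcE.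
case: (urep L i 0) => a a'; case: (urep L j 0) => c c' /=.
by field.
Qed.

End ProjectiveCoordinates.

Section JointMeasurability.
Set Implicit Arguments.
Unset Strict Implicit.
Context {R : realType} {d : nat} {dsp : measure_display}.
Context {T : measurableType dsp}.
Local Notation C := (Cx R).
Local Notation P := (proj_space R d).
Variables (L : T -> borel P) (w : T -> 'M[C]_d.+1).
Hypothesis mL : measurable_fun setT L.
Hypothesis mw : forall i j, cmeasurable (fun t => w t i j).

(** Expanding the squared modulus leaves only the products u_j conj(u_k), which are measurable
    although the u_j themselves may not be. *)
Lemma measurable_hdot_mul (y : 'cV[C]_d.+1) : measurable_fun setT
  (fun t => Normc.normc (hdot (w t *m urep (L t)) y) ^+ 2).
Proof.
pose c j t : C := \sum_i w t i j * (y i 0)^*.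
have mc j : cmeasurable (c j).
  apply: cmeasurable_sum => i; exact: cmeasurableM.
pose u (t : T) := urep (L t).
have -> : (fun t => Normc.normc (hdot (w t *m urep (L t)) y) ^+ 2) =
    fun t => complex.Re
      (\sum_j \sum_k c j t * (c k t)^* * (u t j 0 * (u t k 0)^*)).
  apply/funext => t; rewrite sqr_normcE; congr complex.Re.
  have -> : hdot (w t *m urep (L t)) y = \sum_j c j t * u t j 0.
    rewrite /hdot; under eq_bigr do rewrite mxE mulr_suml.
    rewrite exchange_big; apply: eq_bigr => j _; rewrite mulr_suml.
    by apply: eq_bigr => i _; rewrite mulrAC.
  rewrite rmorph_sum mulr_suml; apply: eq_bigr => j _.
  rewrite mulr_sumr; apply: eq_bigr => k _.
  by rewrite rmorphM mulrACA.
suff [] : cmeasurable (fun t => \sum_j \sum_k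
    c j t * (c k t)^* * (u t j 0 * (u t k 0)^*)) by [].
apply: cmeasurable_sum => j; apply: cmeasurable_sum => k.
apply: cmeasurableM; last first.
  exact: (cmeasurable_comp (cmeasurable_urep_mul j k) mL).
by apply: cmeasurableM => //; exact: cmeasurable_conj.
Qed.

Lemma measurable_sqrt : measurable_fun setT (@Num.sqrt R).
Proof. apply: continuous_measurable_fun; exact: sqrt_continuous. Qed.

Lemma measurable_l2norm_mul :
  measurable_fun setT (fun t => l2norm (w t *m urep (L t))).
Proof.
have hb (z : 'cV[C]_d.+1) k : hdot z (delta_mx k 0) = z k 0.
  rewrite /hdot (bigD1 k)//= big1 ?addr0 => [|l lk].
    by rewrite mxE !eqxx conjC1 mulr1.
  by rewrite mxE (negbTE lk) conjC0 mulr0.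
apply: (measurableT_comp measurable_sqrt); apply: measurable_sum => k.
under eq_fun do rewrite -hb.
exact: measurable_hdot_mul.
Qed.

Lemma measurable_pdist_pact (M : P) :
  measurable_fun setT (fun t => pdist (pact (w t) (L t)) M).
Proof.
(* The first branch is the junk value [L t] of [pact]; in the second, the power -1 is the inverse,
   written as a Borel function. *)
rewrite (_ : (fun t => _) = fun t => if l2norm (w t *m urep (L t)) == 0
    then pdist (L t) M else Num.sqrt (1 -
    Normc.normc (hdot (w t *m urep (L t)) (urep M)) ^+ 2 *
      (l2norm (w t *m urep (L t)) `^ (-1)) ^+ 2)).
  apply: measurable_fun_ifT.
  - apply: measurable_fun_eqr => //; exact: measurable_l2norm_mul.
  - exact: (measurableT_comp (measurable_pdist M) mL).
  - apply: (measurableT_comp measurable_sqrt); apply: measurable_funB => //.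
    apply: measurable_funM; first exact: measurable_hdot_mul.
    apply: measurable_funX; apply: (measurableT_comp (measurable_powR _)).
    exact: measurable_l2norm_mul.
apply/funext => t; rewrite l2norm_eq0; case: ifPn => [/eqP w0|w0].
  suff -> : pact (w t) (L t) = L t by [].
  by apply: val_inj; rewrite /pact val_insubd dim_vline w0 eqxx.
by rewrite pdist_pact// powR_inv1 ?l2norm_ge0// exprVn.
Qed.

End JointMeasurability.

(** * Separability of the projective space *)

Section RationalLines.
Set Implicit Arguments.
Unset Strict Implicit.
Context {R : realType} {d : nat}.
Local Notation C := (Cx R).
Local Notation P := (proj_space R d).

Definition rat_vec (q : 'cV[(rat * rat)%type]_d.+1) : 'cV[C]_d.+1 :=
  \col_i ((ratr (q i 0).1 : R) +i* (ratr (q i 0).2 : R))%C.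

Definition rat_line (q : 'cV[(rat * rat)%type]_d.+1) : P :=
  insubd (point : P) <[rat_vec q]>%VS.

Lemma rat_approx (a e : R) : 0 < e -> exists q : rat, `|a - ratr q| < e.
Proof.
move=> e0; have /rat_in_itvoo[q] : a - e < a + e by lra.
by rewrite in_itv /= => q_in; exists q; rewrite ltr_norml; lra.
Qed.

Lemma l2norm_le (z : 'cV[C]_d.+1) (e : R) :
  (forall i, Normc.normc (z i 0) <= e) -> l2norm z <= d.+1%:R * e.
Proof.
move=> ze; have e0 : 0 <= e by exact: le_trans (normc_ge0 _) (ze ord0).
have d1 : 1 <= d.+1%:R :> R by rewrite ler1n.
rewrite -(@ler_pXn2r _ 2) ?nnegrE ?l2norm_ge0 ?mulr_ge0//.
rewrite /l2norm sqr_sqrtr; last by apply: sumr_ge0 => i _; exact: sqr_ge0.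
apply: (@le_trans _ _ (\sum_(i < d.+1) e ^+ 2)).
  by apply: ler_sum => i _; rewrite ler_pXn2r ?nnegrE ?normc_ge0.
rewrite sumr_const card_ord -[leLHS]mulr_natl exprMn.
apply: ler_wpM2r; first exact: sqr_ge0.
by rewrite expr2 ler_peMr// ltW// (lt_le_trans ltr01).
Qed.

Lemma normc_le (z : C) :
  Normc.normc z <= `|complex.Re z| + `|complex.Im z|.
Proof.
case: z => a b /=; rewrite -(@ler_pXn2r _ 2) ?nnegrE ?sqrtr_ge0 ?addr_ge0//.
rewrite sqr_sqrtr ?addr_ge0 ?sqr_ge0// sqrrD !real_normK ?num_real//.
by rewrite -addrA lerD2l lerDr mulrn_wge0 ?mulr_ge0.
Qed.

Lemma rat_line_dense (L : P) (e : R) : 0 < e ->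
  exists q, pdist L (rat_line q) < e.
Proof.
(* A vector at distance less than 1 from a unit vector is nonzero, so it does span a line. *)
wlog e1 : e / e < 1 => [hw e0|e0].
  have [q qe] : exists q, pdist L (rat_line q) < Num.min e 2^-1.
    apply: hw; last by rewrite lt_min e0 invr_gt0 ltr0n.
    by rewrite gt_min invf_lt1 ?ltr1n ?ltr0n ?orbT.
  by exists q; rewrite (lt_le_trans qe)// ge_min lexx.
have d0 : 0 < d.+1%:R :> R by rewrite ltr0n.
(* Real and imaginary parts each contribute [eps] in [d.+1] coordinates, for a total of e/2. *)
pose eps := e / d.+1%:R / 4.
have eps0 : 0 < eps by rewrite !divr_gt0.
pose qr i := cid (rat_approx (complex.Re (urep L i 0)) eps0).
pose qi i := cid (rat_approx (complex.Im (urep L i 0)) eps0).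
pose q : 'cV[(rat * rat)%type]_d.+1 := \col_i (sval (qr i), sval (qi i)).
have Lq : l2norm (urep L - rat_vec q) < e.
  apply: (@le_lt_trans _ _ (d.+1%:R * (eps + eps))); last first.
    rewrite (_ : _ * _ = e / 2); last by rewrite /eps; field; rewrite gt_eqF.
    by rewrite ltr_pdivrMr// ltr_pMr// ltr1n.
  apply: l2norm_le => i; apply: le_trans (normc_le _) _.
  have hr := svalP (qr i); have hi := svalP (qi i).
  rewrite !mxE /=; move: (sval _) (sval _) hr hi => x y.
  case: (urep L i 0) => a b /= hr hi.
  by apply: lerD; exact: ltW.
have q0 : rat_vec q != 0.
  apply/eqP => q0; move: Lq; rewrite q0 subr0 l2norm_urep.
  by rewrite ltNge ltW.
have [c qE _] : exists2 c : C, rat_vec q = c *: urep (rat_line q) &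
    Normc.normc c = l2norm (rat_vec q).
  by apply: urep_scale; rewrite val_insubd dim_vline q0.
by exists q; apply: le_lt_trans Lq; rewrite qE; exact: pdist_le.
Qed.

(** By density, an open set is the union of the countably many balls of radius 1/(n+1) about
    rational lines that it contains; preimages of such balls are sublevel sets of distances. *)
Lemma measurable_fun_proj (dsp : measure_display) (T : measurableType dsp)
    (F : T -> borel P) :
  (forall M : P, measurable_fun setT (fun t => pdist (F t) M)) ->
  measurable_fun setT F.
Proof.
move=> mF; apply: (@measurability _ _ _ (borel P) setT F (@open P)) => //.
move=> _ [U oU <-]; rewrite setTI.
pose B (q : 'cV[(rat * rat)%type]_d.+1 * nat) : set P :=
  [set L | pdist L (rat_line q.1) < q.2.+1%:R^-1].
rewrite (_ : U = \bigcup_(q in [set q | B q `<=` U]) B q).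
  rewrite preimage_bigcup bigcup_mkcond.
  apply: countable_bigcupT_measurable => [|q]; first exact: countableP.
  case: ifP => // _; rewrite -[X in measurable X]setTI.
  exact: measurable_fun_ltr.
apply/seteqP; split=> [L UL|L [q /= qU]]; last exact: qU.
move: oU; rewrite openE => /(_ L UL) /nbhs_ballP[e /= e0 eU].
pose n := Num.truncn (2 / e).
have n0 : 0 < n.+1%:R^-1 :> R by rewrite invr_gt0.
have ne : n.+1%:R^-1 < e / 2.
  rewrite -[ltRHS]invrK invf_div ltf_pV2 ?posrE ?divr_gt0//.
  exact: Num.Theory.truncnS_gt.
have [q Lq] := rat_line_dense L n0.
exists (q, n) => //= M /= Mq; apply: eU; rewrite ballEmdist /=.
apply: le_lt_trans (pdist_triangle (rat_line q) _ _) _.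
rewrite [X in _ + X]pdist_sym [e]splitr ltrD//.
  exact: lt_trans ne.
exact: lt_trans ne.
Qed.

End RationalLines.

Section MatrixEntries.
Set Implicit Arguments.
Unset Strict Implicit.
Context {R : realType} {n : nat}.
Local Notation C := (Cx R).

Lemma normRe_le (z : C) : `|complex.Re z| <= Normc.normc z.
Proof. by case: z => a b; rewrite /= -sqrtr_sqr ler_wsqrtr// lerDl sqr_ge0. Qed.

Lemma normIm_le (z : C) : `|complex.Im z| <= Normc.normc z.
Proof. by case: z => a b; rewrite /= -sqrtr_sqr ler_wsqrtr// lerDr sqr_ge0. Qed.

Lemma open_mx_entry (g : C -> R) (r : R) (i j : 'I_n.+1) :
  (forall z z' : C, g z - g z' <= Normc.normc (z - z')) ->
  open [set w : 'M[C]_n.+1 | r < g (w i j)].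
Proof.
move=> glip; rewrite openE => w /= rw; apply/nbhs_ballP.
(* Balls of complex matrices have their radius in [C] itself, hence the embedding. *)
exists (g (w i j) - r)%:C%C => /=; first by rewrite ltcR subr_gt0.
move=> w' [_ /(_ i j)]; rewrite -ball_normE /= normCE ltcR => ww'.
have := le_lt_trans (glip _ _) ww'.
by rewrite ltrD2l ltrN2.
Qed.

Lemma cmeasurable_entry (dsp : measure_display) (T : measurableType dsp)
    (v : T -> borel 'M[C]_n.+1) (i j : 'I_n.+1) :
  measurable_fun setT v -> cmeasurable (fun t => (v t : 'M[C]_n.+1) i j).
Proof.
move=> mv; split; apply: measurable_fun_ltlt => r.
  rewrite -[X in measurable X]setTI.
  apply: (mv measurableT [set w : 'M[C]_n.+1 | r < complex.Re (w i j)]).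
  apply: sub_sigma_algebra; apply: (@open_mx_entry (@complex.Re R)) => z z'.
  by rewrite -raddfB; apply: le_trans (ler_norm _) (normRe_le _).
rewrite -[X in measurable X]setTI.
apply: (mv measurableT [set w : 'M[C]_n.+1 | r < complex.Im (w i j)]).
apply: sub_sigma_algebra; apply: (@open_mx_entry (@complex.Im R)) => z z'.
by rewrite -raddfB; apply: le_trans (ler_norm _) (normIm_le _).
Qed.

End MatrixEntries.

(** * The Markov chain driven by [v] *)

Section SigmaFiniteRestriction.
Set Implicit Arguments.
Unset Strict Implicit.
Local Open Scope ereal_scope.
Context {dsp : measure_display} {T : measurableType dsp} {R : realType}.

(** By Markov's inequality the sets where F >= 1/(n+1) have finite measure, and they exhaust the set
    where F > 0. Restricting [mu] to the latter loses nothing for integrands vanishing with [F]. *)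
Lemma sigma_finite_restriction (mu : {measure set T -> \bar R}) (F : T -> R) :
  measurable_fun setT F -> (forall a, (0 <= F a)%R) ->
  \int[mu]_a (F a)%:E < +oo ->
  exists m : {sigma_finite_measure set T -> \bar R},
    forall (C : set T) (G : T -> \bar R), measurable C ->
      measurable_fun setT G -> (forall a, 0 <= G a) ->
      (forall a, F a = 0%R -> G a = 0) ->
      \int[m]_(a in C) G a = \int[mu]_(a in C) G a.
Proof.
move=> mF F0 intF.
pose D := [set a | (0 < F a)%R].
have mD : measurable D.
  by rewrite -[D]setTI; apply: measurable_fun_ltr.
pose E n := [set a | n.+1%:R^-1%:E <= `|(F a)%:E|].
have mE n : measurable (E n).
  rewrite -[E n]setTI; apply: emeasurable_fun_c_infty => //.
  by apply: measurableT_comp => //; exact/measurable_EFinP.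
have sf : sigma_finite setT (mrestr mu mD).
  (* The complement of [D] is null for the restriction; adding it to each set makes them cover the
     whole space. *)
  exists (fun n => ~` D `|` E n) => [|n].
    apply/esym/seteqP; split=> // a _.
    have [Fa|Fa] := pselect (D a); last by exists 0%N => //; left.
    exists (Num.truncn (F a)^-1) => //; right; rewrite /E /=.
    rewrite lee_fin ger0_norm// invf_ple ?posrE ?ltr0n//.
    by rewrite ltW// Num.Theory.truncnS_gt.
  split; first by apply: measurableU => //; exact: measurableC.
  rewrite /mrestr setIUl setICl set0U.
  apply: (@le_lt_trans _ _ (mu (E n))).
    by apply: le_measure; rewrite ?inE//; exact: measurableI.
  have n0 : (0 < n.+1%:R^-1 :> R)%R by rewrite invr_gt0 ltr0n.
  have mF' : measurable_fun setT (EFin \o F) by exact/measurable_EFinP.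
  have := le_integral_abse mu measurableT mF' n0.
  rewrite setTI => h.
  have : n.+1%:R^-1%:E * mu (E n) < +oo.
    apply: (le_lt_trans h).
    rewrite (_ : integral _ _ _ = \int[mu]_a (F a)%:E)//.
    by apply: eq_integral => a _ /=; rewrite ger0_norm.
  have := measure_ge0 mu (E n); case: (mu (E n)) => [r _ _||//].
    exact: ltry.
  by rewrite mulry gtr0_sg// mul1e ltxx.
pose sfm := Measure_isSigmaFinite.Build _ _ _ (mrestr mu mD) sf.
pose m : {sigma_finite_measure set T -> \bar R} := HB.pack (mrestr mu mD) sfm.
exists m => C G mC mG G0 FG.
have mGC : measurable_fun setT (G \_ C).
  by apply/(measurable_restrictT _ mC).1/measurable_funTS.
rewrite [LHS]integral_mkcond [RHS]integral_mkcond.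
transitivity (\int[mrestr mu mD]_a (G \_ C) a) => //.
rewrite integral_mrestr//.
  rewrite integral_mkcond; apply: eq_integral => a _; rewrite [LHS]patchE.
  case: ifPn => //; rewrite notin_setE /D /= => /negP.
  rewrite lt_neqAle F0 andbT negbK => /eqP Fa.
  by rewrite patchE FG//; case: ifP.
by move=> a; rewrite patchE; case: ifP.
Qed.

End SigmaFiniteRestriction.

(** * Rectangles of tuples, to match cylinders with finite marginals *)

Section TupleRectangles.
Set Implicit Arguments.
Unset Strict Implicit.
Context {dsp : measure_display} {T : measurableType dsp}.
Implicit Types (l : seq (set T)).

Definition trect l : set ((size l).-tuple T) :=
  [set t | forall i : 'I_(size l), nth setT l i (tnth t i)].

Lemma measurable_trect l : measurable_seq l -> measurable (@trect l).
Proof.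
move=> ml.
rewrite (_ : @trect l =
    \bigcap_(i : 'I_(size l)) (tnth (T:=T) ^~ i) @^-1` nth setT l i).
  apply: fin_bigcap_measurable => // i _; rewrite -[X in measurable X]setTI.
  exact: measurable_tnth.
by apply/seteqP; split=> t h i; [move=> _; exact: h|exact: h].
Qed.

Lemma trect_cons C l a (t : (size l).-tuple T) :
  @trect (C :: l) [tuple of a :: t] <-> C a /\ @trect l t.
Proof.
split=> [h|[Ca lt] i].
  split; first by have := h ord0; rewrite tnth0.
  by move=> i; have := h (lift ord0 i); rewrite tnthS.
by case: (unliftP ord0 i) => [j|] ->; rewrite ?tnth0// tnthS; exact: lt.
Qed.

Lemma rect_trect l :
  rect l = [set w : seq_space T | @trect l [tuple w i | i < size l]].
Proof.
suff H w : rect l w <-> forall i, (i < size l)%N -> nth setT l i (w i).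
  apply/seteqP; split=> w /=; rewrite H => h.
    by move=> i; rewrite tnth_mktuple; exact: h.
  by move=> i il; have := h (Ordinal il); rewrite tnth_mktuple.
elim: l w => [|C l IHl] w; first by split.
split=> [[Cw /IHl lw] [|i] il|h]; [exact: Cw|exact: lw|].
split; first exact: (h 0%N).
by apply/IHl => i il; exact: (h i.+1).
Qed.

End TupleRectangles.

Section RandomWalk.
Set Implicit Arguments.
Unset Strict Implicit.
Context {R : realType} {d : nat} {A : ptopologicalType}.
Local Notation P := (proj_space R d).
Variables (mu : {measure set (borel A) -> \bar R}).
Variables (v : borel A -> 'M[Cx R]_d.+1) (s k : R) (e : P -> R).
Hypothesis v_meas :
  measurable_fun [set: borel A] (v : borel A -> borel 'M[Cx R]_d.+1).
Hypothesis s_gt0 : 0 < s.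
Hypothesis k_gt0 : 0 < k.
Hypothesis e_cont : continuous e.
Hypothesis e_gt0 : forall x, 0 < e x.
Hypothesis e_eigen : forall x, Gamma mu v s e x = k * e x.

Definition step (z : borel P * borel A) : borel P := pact (v z.2) z.1.

Definition weight (z : borel P * borel A) : R := density s k e 1 z.1 (v z.2).

Lemma cmeasurable_step_entry i j :
  cmeasurable (fun z : borel P * borel A => v z.2 i j).
Proof. exact: (cmeasurable_comp (cmeasurable_entry i j v_meas)). Qed.

Lemma measurable_step : measurable_fun setT step.
Proof.
apply: measurable_fun_proj => M; apply: measurable_pdist_pact => //.
exact: cmeasurable_step_entry.
Qed.

Lemma measurable_l2norm_step :
  measurable_fun setT (fun z : borel P * borel A => l2norm (v z.2 *m urep z.1)).
Proof.
apply: measurable_l2norm_mul => //; exact: cmeasurable_step_entry.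
Qed.

Lemma measurable_eigenfun : measurable_fun setT (e : borel P -> R).
Proof. exact: continuous_borel. Qed.

Lemma measurable_weight : measurable_fun setT weight.
Proof.
rewrite (_ : weight = fun z => (k ^+ 1)^-1 * (e (step z) * e z.1 `^ (-1)) *
    l2norm (v z.2 *m urep z.1) `^ s).
  apply: measurable_funM.
    apply: measurable_funM => //; apply: measurable_funM.
      exact: (measurableT_comp measurable_eigenfun measurable_step).
    apply: (measurableT_comp (measurable_powR _)).
    exact: (measurableT_comp measurable_eigenfun measurable_fst).
  apply: (measurableT_comp (measurable_powR _)).
  exact: measurable_l2norm_step.
by apply/funext => z; rewrite powR_inv1// ltW.
Qed.

Lemma weight_ge0 z : 0 <= weight z.
Proof.
by rewrite /weight /density !mulr_ge0 ?powR_ge0 ?invr_ge0 ?exprn_ge0 ?ltW.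
Qed.

(** The real integral in [Gamma] reads 0 when the extended one is infinite; since [k * e x] is
    nonzero, the extended integral must be finite. *)
Lemma int_eigenfun x : (\int[mu]_a (e (pact (v a) x) *
  l2norm (v a *m urep x) `^ s)%:E = (k * e x)%:E)%E.
Proof.
have kex : k * e x != 0 by rewrite mulf_neq0// gt_eqF.
have := e_eigen x; rewrite /Gamma /Rintegral => h.
rewrite -h fineK//; apply: contraNT kex; rewrite -h.
by case: (integral _ _ _).
Qed.

Lemma weight0 z : v z.2 = 0 -> weight z = 0.
Proof.
by move=> v0; apply: density_eq0; rewrite ?gt_eqF// v0 mul0mx.
Qed.

(* Tonelli's theorem needs sigma-finiteness, which [mu] has only where [v] does
   not vanish: there the sum of the integrands of [Gamma e] at the lines of the
   canonical basis is positive, and it is integrable by the eigenvalue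
   equation. *)
Lemma sigma_finite_off_kernel :
  exists m : {sigma_finite_measure set (borel A) -> \bar R},
    forall (C : set (borel A)) (G : borel A -> \bar R), measurable C ->
      measurable_fun setT G -> (forall a, 0 <= G a)%E ->
      (forall a, v a = 0 -> G a = 0%E) ->
      (\int[m]_(a in C) G a = \int[mu]_(a in C) G a)%E.
Proof.
have bM (j : 'I_d.+1) : exists M : P, val M = <[delta_mx j (@ord0 0)]>%VS.
  apply: line_ex; apply/eqP => /matrixP/(_ j 0); rewrite !mxE !eqxx => /eqP.
  by rewrite oner_eq0.
pose M j := sval (cid (bM j)).
pose g j a := e (pact (v a) (M j)) * l2norm (v a *m urep (M j)) `^ s.
have g0 j a : 0 <= g j a by rewrite mulr_ge0 ?powR_ge0// ltW.
have mg j : measurable_fun setT (g j).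
  have mM := @pair1_measurable _ _ _ (borel A) (M j : borel P).
  apply: measurable_funM.
    apply: (measurableT_comp measurable_eigenfun).
    exact: (measurableT_comp measurable_step mM).
  apply: (measurableT_comp (measurable_powR _)).
  exact: (measurableT_comp measurable_l2norm_step mM).
pose F a := \sum_j g j a.
have F0 a : 0 <= F a by exact: sumr_ge0.
(* As [e > 0], each term of the sum vanishes only if [v a] kills a basis vector, that is, has a zero
   column. *)
have FE a : F a = 0 -> v a = 0.
  move=> /eqP; rewrite psumr_eq0// => /allP Fa.
  apply/matrixP => i j; rewrite mxE.
  have := Fa j (mem_index_enum _); rewrite mulf_eq0 gt_eqF//=.
  rewrite powR_eq0 l2norm_eq0 => /andP[/eqP vM _].
  have [c cE _] := urep_scale (svalP (cid (bM j))).
  have : (v a *m delta_mx j 0) i (0 : 'I_1) = 0.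
    by rewrite cE -scalemxAr vM scaler0 mxE.
  by rewrite -colE mxE.
have [|//||m mE] := @sigma_finite_restriction _ _ _ mu F.
- exact: measurable_sum.
- under eq_integral do rewrite -sumEFin.
  rewrite ge0_integral_sum//.
  + by under eq_bigr do rewrite int_eigenfun; rewrite sumEFin ltry.
  + by move=> j; exact/measurable_EFinP.
  + by move=> j a _; rewrite lee_fin.
exists m => C G mC mG G0 vG; apply: mE => // a /FE; exact: vG.
Qed.

(** * Transition operator of the chain and its path measures *)

Variable m : {sigma_finite_measure set (borel A) -> \bar R}.
Hypothesis int_m : forall (C : set (borel A)) (G : borel A -> \bar R),
  measurable C -> measurable_fun setT G -> (forall a, 0 <= G a)%E ->
  (forall a, v a = 0 -> G a = 0%E) ->
  (\int[m]_(a in C) G a = \int[mu]_(a in C) G a)%E.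

Local Notation tr := (trans m step weight).

Lemma trans_mu C (f : borel P -> \bar R) x : measurable C ->
  measurable_fun setT f -> (forall y, 0 <= f y)%E ->
  tr C f x = (\int[mu]_(a in C) (f (step (x, a)) * (weight (x, a))%:E))%E.
Proof.
move=> mC mf f0; apply: int_m => //.
- exact: measurable_trans_section measurable_step measurable_weight _ _ mf.
- by move=> a; exact: trans_integrand_ge0 weight_ge0 _ _ f0.
- by move=> a va; rewrite weight0// mule0.
Qed.

(** This is the eigenvalue equation divided by [k * e x]. *)
Lemma weight_mass x : (\int[m]_a (weight (x, a))%:E = 1)%E.
Proof.
rewrite int_m//; last first.
- by move=> a va; rewrite weight0.
- by move=> a; rewrite lee_fin weight_ge0.
- apply/measurable_EFinP.
  exact: (measurableT_comp measurable_weight (pair1_measurable x)).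
have ke0 : k * e x != 0 by rewrite mulf_neq0// gt_eqF.
rewrite (eq_integral (fun a => ((k * e x)^-1)%:E * (e (pact (v a) x) *
  l2norm (v a *m urep x) `^ s)%:E)%E); last first.
  move=> a _; rewrite -EFinM /weight /density /= expr1 invfM.
  by congr EFin; rewrite mulrACA !mulrA.
rewrite ge0_integralZl_EFin ?int_eigenfun -?EFinM ?mulVf//.
- by move=> a _; rewrite lee_fin mulr_ge0 ?powR_ge0// ltW.
- apply/measurable_EFinP; apply: measurable_funM.
    apply: (measurableT_comp measurable_eigenfun).
    exact: (measurableT_comp measurable_step (pair1_measurable x)).
  apply: (measurableT_comp (measurable_powR _)).
  exact: (measurableT_comp measurable_l2norm_step (pair1_measurable x)).
- by rewrite invr_ge0 mulr_ge0 ?ltW.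
Qed.

Definition rect_prob (l : seq (set (borel A))) : borel P -> \bar R :=
  foldr (fun C => tr C) (fun=> 1%E) l.

Lemma rect_prob_ge0 l x : (0 <= rect_prob l x)%E.
Proof.
elim: l x => [|C l IHl] x /=; first exact: lee01.
by apply: trans_ge0 => //; exact: weight_ge0.
Qed.

Lemma measurable_rect_prob l : measurable_seq l ->
  measurable_fun setT (rect_prob l).
Proof.
elim: l => [|C l IHl]; first by move=> _; exact: measurable_cst.
move=> /measurable_seq_cons[mC ml].
rewrite -[rect_prob _]/(tr C (rect_prob l)).
apply: measurable_trans; [exact: measurable_step|exact: measurable_weight| |
  exact: mC|exact: IHl|exact: rect_prob_ge0].
exact: weight_ge0.
Qed.

Lemma vprod_cons n (a : borel A) (t : n.-tuple (borel A)) :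
  vprod v [tuple of a :: t] = vprod v t *m v a.
Proof. by rewrite /vprod /= rev_cons -cats1 big_cat big_seq1. Qed.

Lemma density_vprod0 x (t : 0.-tuple (borel A)) :
  density s k e 0 x (vprod v t) = 1.
Proof.
rewrite tuple0 /density /vprod big_nil expr0 invr1 mul1r.
rewrite mul1mx l2norm_urep powR1 mulr1.
suff -> : pact 1 x = x by rewrite divff// gt_eqF.
apply: val_inj; rewrite val_pact mul1mx; first by rewrite -proj_urep.
by rewrite -l2norm_eq0 l2norm_urep oner_eq0.
Qed.

Lemma eq_iterated_integral n (F G : n.-tuple (borel A) -> \bar R) :
  F =1 G -> iterated_integral mu F = iterated_integral mu G.
Proof. by move=> /funext ->. Qed.

(** The constant [c] is there for the induction: fixing the first letter [a] leaves the factor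
    [\1_C a * weight (x, a)] in front of the remaining density, by the cocycle identity. *)
Lemma iterated_integral_rect l (c : R) x : measurable_seq l -> 0 <= c ->
  iterated_integral mu (fun t : (size l).-tuple (borel A) =>
    (c * (\1_(@trect _ _ l) t * density s k e (size l) x (vprod v t)))%:E) =
  (c%:E * rect_prob l x)%E.
Proof.
elim: l c x => [|C l IHl] c x.
  move=> _ _ /=; rewrite density_vprod0 mulr1 indicE mem_set ?mulr1 ?mule1//.
  by case.
move=> /measurable_seq_cons[mC ml] c0 /=.
transitivity (\int[mu]_(a in C) (c%:E *
    (rect_prob l (step (x, a)) * (weight (x, a))%:E)))%E.
  rewrite [RHS]integral_mkcond; apply: eq_integral => a _.
  rewrite [RHS]patchE.
  transitivity (((c * \1_C a * weight (x, a))%:E *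
      rect_prob l (step (x, a)))%E).
    have c'0 : 0 <= c * \1_C a * weight (x, a).
      by apply: mulr_ge0 (weight_ge0 _); apply: mulr_ge0.
    rewrite -(IHl _ _ ml c'0).
    apply: eq_iterated_integral => t; apply: (congr1 EFin).
    have s0 : s != 0 by rewrite gt_eqF.
    have e0 y : e y != 0 by rewrite gt_eqF.
    rewrite vprod_cons (density_mul k _ _ _ _ s0 e0).
    have -> : \1_(@trect _ _ (C :: l)) [tuple of a :: t] =
        \1_C a * \1_(@trect _ _ l) t :> R.
      rewrite !indicE; apply/eqP.
      have [Ca|Ca] := boolP (a \in C); last first.
        rewrite mul0r memNset// => /trect_cons[/mem_set Ca'] _.
        by rewrite Ca' in Ca.
      rewrite mul1r; have [lt|lt] := boolP (t \in _).
        by rewrite mem_set//=; apply/trect_cons; rewrite !inE in Ca lt *.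
      by rewrite memNset// => /trect_cons[_ /mem_set lt']; rewrite lt' in lt.
    rewrite -[weight (x, a)]/(density s k e 1 x (v a)).
    rewrite -[step (x, a)]/(pact (v a) x).
    move: (density _ _ _ 1 _ _) (density _ _ _ _ (pact _ _) _) => D1 D2.
    by ring.
  rewrite indicE; case: (a \in C); last by rewrite mulr0 mul0r mul0e.
  by rewrite mulr1 EFinM -muleA; congr (_ * _)%E; rewrite muleC.
have mr := measurable_rect_prob ml.
rewrite ge0_integralZl_EFin//.
- by rewrite trans_mu//; exact: rect_prob_ge0.
- by move=> a _; rewrite mule_ge0 ?rect_prob_ge0// lee_fin weight_ge0.
- apply/measurable_funTS.
  exact: measurable_trans_section measurable_step measurable_weight _ _ mr.
Qed.

Variable Qx : P -> probability (seq_space (borel A)) R.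
Hypothesis Qx_marginals : forall x, Q_marginals mu v s k e x (Qx x).

Lemma Qx_rectE l x : measurable_seq l -> Qx x (rect l) = rect_prob l x.
Proof.
(* The marginals are prescribed only for n > 0, so the empty rectangle is treated apart. *)
case: l => [_|C l ml]; first by rewrite /rect /= probability_setT.
rewrite rect_trect.
rewrite [LHS](Qx_marginals x (ltn0Sn (size l)) (measurable_trect ml)).
rewrite -[RHS]mul1e -iterated_integral_rect//.
by apply: eq_iterated_integral => t; rewrite mul1r.
Qed.

Lemma Qx_rect_trans C l x : measurable C -> measurable_seq l ->
  Qx x (rect (C :: l)) = tr C (fun y => Qx y (rect l)) x.
Proof.
move=> mC ml; rewrite Qx_rectE; last exact/measurable_seq_cons.
by congr trans; apply/funext => y; rewrite Qx_rectE.
Qed.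

Lemma Qop_trans (f : borel P -> R) (b : R) x : measurable_fun setT f ->
  (forall y, 0 <= f y <= b) ->
  (Qop mu v s k e f x)%:E = tr setT (EFin \o f) x.
Proof.
move=> mf fb.
have mf' : measurable_fun setT (EFin \o f) by exact/measurable_EFinP.
have f0 y : (0 <= (EFin \o f) y)%E by rewrite lee_fin; case/andP: (fb y).
have trb : (tr setT (EFin \o f) x <= b%:E)%E.
  exact: (trans_le measurable_step measurable_weight weight_ge0 weight_mass).
have tr_fin : tr setT (EFin \o f) x \is a fin_num.
  rewrite ge0_fin_numE; first exact: le_lt_trans trb (ltry _).
  by apply: trans_ge0 => //; exact: weight_ge0.
rewrite -(fineK tr_fin); congr (EFin (fine _)).
by rewrite trans_mu.
Qed.

Lemma integrable_step (f : borel P -> R) (b : R) x : measurable_fun setT f ->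
  (forall y, 0 <= f y <= b) ->
  mu.-integrable setT
    (EFin \o (fun a => f (pact (v a) x) * density s k e 1 x (v a))).
Proof.
move=> mf fb.
have mf' : measurable_fun setT (EFin \o f) by exact/measurable_EFinP.
have f0 y : (0 <= (EFin \o f) y)%E by rewrite lee_fin; case/andP: (fb y).
apply/integrableP; split.
  exact: (measurable_trans_section measurable_step measurable_weight x mf').
rewrite (_ : integral _ _ _ = tr setT (EFin \o f) x).
  by rewrite -(Qop_trans _ mf fb) ltry.
rewrite trans_mu//; apply: eq_integral => a _ /=.
rewrite ger0_norm// mulr_ge0//; first by case/andP: (fb (pact (v a) x)).
exact: weight_ge0 (x, a).
Qed.

Lemma trans_invariant_of_Q (eta : probability (borel P) R) :
  Q_invariant mu v s k e eta -> trans_invariant m step weight eta.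
Proof.
move=> inv f b mf fb.
have fin_int (g : borel P -> \bar R) : eta.-integrable setT g ->
    (\int[eta]_x g x = (fine (\int[eta]_x g x))%:E)%E.
  by move=> gi; rewrite fineK//; exact: integrable_fin_num.
rewrite fin_int; last first.
  exact: (integrable_trans measurable_step measurable_weight weight_ge0
    weight_mass eta measurableT mf fb).
rewrite [RHS]fin_int; last exact: (integrable_bounded_fun eta mf fb).
have E : \int[eta]_x Qop mu v s k e f x = \int[eta]_x f x.
  apply: inv => //; exists b => x.
  by have /andP[f0 f1] := fb x; rewrite ger0_norm.
congr EFin; transitivity (\int[eta]_x Qop mu v s k e f x) => //.
rewrite /Rintegral; apply: (congr1 fine); apply: eq_integral => x _.
by rewrite (Qop_trans _ mf fb).
Qed.

(** A function bounded by [b] is shifted to [g = f + b], with values in [0, 2b]; since the operator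
    fixes constants, the shift cancels. Uniqueness of the invariant probability thereby transfers to
    the abstract kernel. *)
Lemma Q_of_trans_invariant (eta : probability (borel P) R) :
  trans_invariant m step weight eta -> Q_invariant mu v s k e eta.
Proof.
move=> inv f mf [b fb].
have fNb x : - b <= f x <= b by rewrite -ler_norml.
pose g x := f x + b.
have mg : measurable_fun setT (g : borel P -> R) by exact: measurable_funD.
have gb x : 0 <= g x <= b + b.
  by have /andP[h1 h2] := fNb x; rewrite /g -lerBlDr sub0r h1 lerD2r.
have gi := integrable_bounded_fun eta mg gb.
have bi : eta.-integrable setT (EFin \o cst b).
  exact: finite_measure_integrable_cst.
have b0 : 0 <= b by exact: le_trans (normr_ge0 _) (fb point).
have mb : measurable_fun setT (cst b : borel P -> R) by exact: measurable_cst.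
have bb x : 0 <= (cst b : borel P -> R) x <= b by rewrite b0 lexx.
have Qopb x : Qop mu v s k e (cst b) x = b.
  apply: EFin_inj; rewrite (Qop_trans _ mb bb).
  exact: (trans_cst step measurable_weight weight_ge0 weight_mass).
have QopE x : Qop mu v s k e f x = Qop mu v s k e g x - b.
  rewrite -[in RHS](Qopb x) /Qop -RintegralB//.
  - by apply: eq_Rintegral => a _; rewrite -mulrBl /g addrK.
  - exact: integrable_step mg gb.
  - exact: integrable_step mb bb.
have QgE : EFin \o Qop mu v s k e g = tr setT (EFin \o g).
  by apply/funext => x; exact: Qop_trans mg gb.
have Qgi : eta.-integrable setT (EFin \o Qop mu v s k e g).
  rewrite QgE; exact: (integrable_trans measurable_step measurable_weight
    weight_ge0 weight_mass eta measurableT mg gb).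
transitivity (\int[eta]_x (Qop mu v s k e g x - b)).
  by apply: eq_Rintegral => x _.
transitivity (\int[eta]_x (g x - b)); last first.
  by apply: eq_Rintegral => x _; rewrite /g addrK.
rewrite !RintegralB//; congr (_ - _).
rewrite /Rintegral; congr fine; rewrite -(inv g _ mg gb).
by apply: eq_integral => x _; rewrite (Qop_trans _ mg gb).
Qed.

End RandomWalk.

Theorem corollary7p6 (R : realType) (d : nat) (A : ptopologicalType)
  (A_polish : polish R A)
  (mu : {measure set (borel A) -> \bar R})
  (v : borel A -> 'M[Cx R]_d.+1)
  (v_meas : measurable_fun [set: borel A] (v : borel A -> borel 'M[Cx R]_d.+1))
  (s_minus : R) (s_plus : \bar R)
  (s_minus_gt0 : 0 < s_minus) (s_minus_plus : (s_minus%:E < s_plus)%E)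
  (moments : forall s : R, s_minus <= s -> (s%:E <= s_plus)%E ->
     (\int[mu]_a (opnorm (v a) `^ s)%:E < +oo)%E)
  (mu_irreducible :
     irreducible (pushforward mu (v : borel A -> borel 'M[Cx R]_d.+1)))
  (mu_contracting :
     contracting (pushforward mu (v : borel A -> borel 'M[Cx R]_d.+1)))
  (s : R) (s_gt : s_minus < s) (s_lt : (s%:E < s_plus)%E)
  (k : R) (k_gt0 : 0 < k) (k_rate : growth_rate mu v s k)
  (e : proj_space R d -> R) (e_cont : continuous e) (e_gt0 : forall x, 0 < e x)
  (e_eigen : forall x, Gamma mu v s e x = k * e x)
  (sigma : probability (borel (proj_space R d)) R)
  (sigma_eigen : forall phi : proj_space R d -> R, continuous phi ->
     \int[sigma]_x Gamma mu v s phi x = k * \int[sigma]_x phi x)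
  (e_sigma : \int[sigma]_x e x = 1)
  (Qx : proj_space R d -> probability (seq_space (borel A)) R)
  (Qx_marginals : forall x, Q_marginals mu v s k e x (Qx x))
  (eta : probability (borel (proj_space R d)) R)
  (eta_invariant : Q_invariant mu v s k e eta)
  (eta_unique : forall eta' : probability (borel (proj_space R d)) R,
     Q_invariant mu v s k e eta' ->
     forall B, measurable B -> eta' B = eta B)
  (Q : probability (seq_space (borel A)) R)
  (Q_mixture : forall B, measurable B -> Q B = (\int[eta]_x Qx x B)%E) :
  ergodic Q (@left_shift _ (borel A)).

Proof.
have s_gt0 : 0 < s by exact: lt_trans s_gt.
have [m int_m] := sigma_finite_off_kernel v_meas k_gt0 e_cont e_gt0 e_eigen.
have m_step := measurable_step v_meas.
have m_weight := measurable_weight s k v_meas e_cont e_gt0.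
have weight0 := weight_ge0 v s k_gt0 e_gt0.
have mass := weight_mass v_meas s_gt0 k_gt0 e_cont e_gt0 e_eigen int_m.
have inv := trans_invariant_of_Q v_meas s_gt0 k_gt0 e_cont e_gt0 e_eigen int_m
  eta_invariant.
apply: (shift_ergodic m_step m_weight weight0 mass inv _ _ Q_mixture).
  move=> P /(Q_of_trans_invariant v_meas s_gt0 k_gt0 e_cont e_gt0 e_eigen
    int_m).
  exact: eta_unique.
move=> C l x.
exact: (Qx_rect_trans v_meas s_gt0 k_gt0 e_cont e_gt0 int_m Qx_marginals).
Qed.
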